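(* Let $l\ge1$ be an integer, let $K_l$ be the $l$-Kronecker quiver, and let $\mathrm{Stab}_K^\dagger(\mathcal{D}^b(\mathrm{mod}\,\mathbb{C}K_l))$ be the distinguished connected component of the space of stability conditions on $\mathcal{D}^b(\mathrm{mod}\,\mathbb{C}K_l)$. Then the metric space $(\mathrm{Stab}_K^\dagger(\mathcal{D}^b(\mathrm{mod}\,\mathbb{C}K_l))/\mathbb{C},\bar{d_B})$ is not CAT(0).
   Context: $K_l$ is the quiver with two vertices $1,2$ and $l$ arrows $\alpha_1,\dots,\alpha_l:1\to2$. $\mathcal{T}=\mathcal{D}^b(\mathrm{mod}\,\mathbb{C}K_l)$ is the bounded derived category of finitely generated modules over the path algebra (i.e. finite-dimensional representations of $K_l$); $S_1,S_2$ are the simple modules at the vertices. $K(\mathcal{T})\cong\mathbb{Z}^2$ is the Grothendieck group, with basis $[S_1],[S_2]$; fix a norm on $K(\mathcal{T})\otimes\mathbb{R}$. Stability condition on $\mathcal{T}$: a pair $\sigma=(Z,\mathcal{P})$ of a group homomorphism $Z:K(\mathcal{T})\to\mathbb{C}$ and a family $\{\mathcal{P}(\phi)\}_{\phi\in\mathbb{R}}$ of full additive subcategories of $\mathcal{T}$ such that: (1) for $0\ne E\in\mathcal{P}(\phi)$, $Z(E)\in\mathbb{R}_{>0}e^{i\pi\phi}$; (2) $\mathcal{P}(\phi+1)=\mathcal{P}(\phi)[1]$; (3) $\mathrm{Hom}(E_1,E_2)=0$ for $E_i\in\mathcal{P}(\phi_i)$, $\phi_1>\phi_2$; (4) every $E\neq0$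 has a Harder--Narasimhan filtration, i.e. exact triangles $E_{i-1}\to E_i\to A_i\to E_{i-1}[1]$, $i=1,\dots,p$, with $E_0=0$, $E_p=E$, $0\ne A_i\in\mathcal{P}(\phi_i)$, $\phi_1>\dots>\phi_p$; (5) there is $C>0$ with $\|[E]\|<C|Z(E)|$ for all $0\ne E\in\mathcal{P}(\phi)$ and all $\phi$. Set $\phi^+_\sigma(E)=\phi_1$, $\phi^-_\sigma(E)=\phi_p$, $m_\sigma(E)=\sum_i|Z(A_i)|$. $\mathrm{Stab}_K(\mathcal{T})$ is the set of stability conditions, topologized by the generalized metric $$d_B(\sigma,\tau)=\sup_{E\neq0}\Big\{|\phi^+_\sigma(E)-\phi^+_\tau(E)|,\ |\phi^-_\sigma(E)-\phi^-_\tau(E)|,\ \Big|\log\tfrac{m_\sigma(E)}{m_\tau(E)}\Big|\Big\}\in[0,\infty],$$ finite on each connected component. A group homomorphism $Z:K(\mathcal{T})\to\mathbb{C}$ with $Z(S_1),Z(S_2)\in\mathbb{H}_-:=\{re^{i\pi\phi}: r>0,\ \phi\in(0,1]\}$ determines a stability condition $(Z,\mathrm{mod}\,\mathbb{C}K_l)$: for $\phi\in(0,1]$, $\mathcal{P}(\phi)$ consists of $0$ and the $Z$-semistable modules $E$ of phase $\phi=\frac1\pi\arg Z(E)$ (i.e. $\arg Z(A)\le\arg Z(E)$ for all submodules $0\neq A\subset E$, with $\arg\in(0,\pi]$), extended by $\mathcal{P}(\phi+1)=\mathcal{P}(\phi)[1]$. The distinguished component $\mathrm{Stab}_K^\dagger(\mathcal{T})$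 is the connected component containing all of these (they form a connected set). $\mathbb{C}$ acts on the right, isometrically, by $\sigma.\lambda=(e^{-i\pi\lambda}Z_\sigma,\{\mathcal{P}_\sigma(\phi+\mathrm{Re}\,\lambda)\}_\phi)$; the orbits are closed, and the quotient metric on $\mathrm{Stab}_K^\dagger(\mathcal{T})/\mathbb{C}$ is $\bar{d_B}(\bar\sigma,\bar\tau)=\inf_{\lambda\in\mathbb{C}}d_B(\sigma,\tau.\lambda)$. A geodesic from $x$ to $y$ is a continuous $\gamma:[0,1]\to X$ with $\gamma(0)=x,\gamma(1)=y$ and $d(\gamma(t),\gamma(t'))=d(x,y)|t-t'|$. A space is geodesic if any two distinct points are joined by a geodesic. CAT(0): geodesic, and for every geodesic triangle (union of three geodesics $[x,y],[y,z],[z,x]$) with comparison triangle in the Euclidean plane (same side lengths), distances between points of the triangle are at most the distances between the corresponding comparison points. *)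

(* Defs.v *)
From HB Require Import structures.
From mathcomp Require Import all_boot all_order all_algebra.
From mathcomp Require Import complex zify.
From mathcomp Require Import all_classical all_reals all_analysis.

Set Implicit Arguments.
Unset Strict Implicit.
Unset Printing Implicit Defensive.

Import Order.TTheory GRing.Theory Num.Theory.
Import numFieldNormedType.Exports.
Import Normc.

Local Open Scope classical_set_scope.
Local Open Scope ring_scope.

(* A finite-dimensional representation of the Kronecker quiver K_l is given by
   matrices: the space at the vertex v is the space of row vectors 'rV_(M v), and
   linear maps act on the right. *)
Section Kronecker.
Context (K : fieldType) (l : nat).

Definition v1 : 'I_2 := ord0.
Definition v2 : 'I_2 := ord_max.

Record rep := Rep {
  rdim :> 'I_2 -> nat;
  arr : 'I_l -> 'M[K]_(rdim v1, rdim v2) }.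

Record rhom (M N : rep) := RHom {
  rmap :> forall v, 'M[K]_(M v, N v);
  rmapP : forall a, arr M a *m rmap v2 = rmap v1 *m arr N a }.

Program Definition rid (M : rep) : rhom M M := @RHom M M (fun v => 1%:M) _.
Next Obligation. by move=> M a; rewrite mulmx1 mul1mx. Qed.

Program Definition rcomp (M N P : rep) (g : rhom N P) (f : rhom M N) :
    rhom M P :=
  @RHom M P (fun v => f v *m g v) _.
Next Obligation.
by move=> M N P g f a; rewrite mulmxA rmapP -mulmxA rmapP mulmxA.
Qed.

Program Definition rzero (M N : rep) : rhom M N := @RHom M N (fun v => 0) _.
Next Obligation. by move=> M N a; rewrite mulmx0 mul0mx. Qed.

Program Definition ropp (M N : rep) (f : rhom M N) : rhom M N :=
  @RHom M N (fun v => - f v) _.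
Next Obligation. by move=> M N f a; rewrite mulmxN mulNmx rmapP. Qed.

Definition rsum (M N : rep) : rep :=
  @Rep (fun v => (M v + N v)%N) (fun a => block_mx (arr M a) 0 0 (arr N a)).

Definition simple (i : 'I_2) : rep := @Rep (fun v => v == i) (fun=> 0).

Definition rep0 : rep := @Rep (fun=> 0%N) (fun=> 0).

(* (x, y) |-> (f x, g x + h y) *)
Program Definition rblock (M M' N N' : rep)
    (f : rhom M M') (g : rhom M N') (h : rhom N N') :
    rhom (rsum M N) (rsum M' N') :=
  @RHom (rsum M N) (rsum M' N') (fun v => block_mx (f v) (g v) 0 (h v)) _.
Next Obligation.
move=> M M' N N' f g h a /=.
by rewrite !mulmx_block !(mul0mx, mulmx0, add0r, addr0) !rmapP.
Qed.

(* Bounded complexes, with cohomological indexing. *)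
Record cpx := Cpx {
  cob :> int -> rep;
  cd : forall n, rhom (cob n) (cob (n + 1));
  cdd : forall n v, cd n v *m cd (n + 1) v = 0;
  cbd : exists N : nat, forall n, (N < `|n|)%N ->
          forall v, cob n v = 0%N }.

Record cmap (X Y : cpx) := CMap {
  cmor :> forall n, rhom (X n) (Y n);
  cmorP : forall n v, cmor n v *m cd Y n v = cd X n v *m cmor (n + 1) v }.

Program Definition cidmap (X : cpx) : cmap X X :=
  @CMap X X (fun n => rid (X n)) _.
Next Obligation. by move=> X n v /=; rewrite mulmx1 mul1mx. Qed.

Program Definition ccomp (X Y Z : cpx) (g : cmap Y Z) (f : cmap X Y) :
    cmap X Z :=
  @CMap X Z (fun n => rcomp (g n) (f n)) _.
Next Obligation.
by move=> X Y Z g f n v /=; rewrite -mulmxA cmorP !mulmxA cmorP.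
Qed.

Program Definition czero (X Y : cpx) : cmap X Y :=
  @CMap X Y (fun n => rzero (X n) (Y n)) _.
Next Obligation. by move=> X Y n v /=; rewrite mulmx0 mul0mx. Qed.

(* f induces a bijection on H^(n+1) = ker d^(n+1) / im d^n for every n,
   i.e. in every degree, at both vertices. *)
Definition qis (X Y : cpx) (f : cmap X Y) : Prop :=
  forall n v,
    (forall x : 'rV_(X (n + 1) v), x *m cd X (n + 1) v = 0 ->
       (x *m f (n + 1)%R v <= cd Y n v)%MS -> (x <= cd X n v)%MS) /\
    (forall y : 'rV_(Y (n + 1) v), y *m cd Y (n + 1) v = 0 ->
       exists2 x : 'rV_(X (n + 1) v), x *m cd X (n + 1) v = 0 &
         ((y - x *m f (n + 1) v)%R <= cd Y n v)%MS).

Program Definition shift (X : cpx) : cpx :=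
  @Cpx (fun n => X (n + 1)) (fun n => ropp (cd X (n + 1))) _ _.
Next Obligation. by move=> X n v /=; rewrite mulNmx mulmxN opprK cdd. Qed.
Next Obligation.
move=> X; have [N HN] := cbd X; exists N.+1 => n Nn v; apply: HN; lia.
Qed.

Program Definition shift_map (X Y : cpx) (f : cmap X Y) :
    cmap (shift X) (shift Y) :=
  @CMap (shift X) (shift Y) (fun n => f (n + 1)) _.
Next Obligation. by move=> X Y f n v /=; rewrite mulmxN mulNmx cmorP. Qed.

Lemma shift_qis (X Y : cpx) (f : cmap X Y) : qis f -> qis (shift_map f).
Proof.
move=> qf n v /=; have [inj surj] := qf (n + 1) v; split=> [x|y].
  by move/eqP; rewrite mulmxN oppr_eq0 !eqmx_opp => /eqP; exact: inj.
move/eqP; rewrite mulmxN oppr_eq0 => /eqP/surj[x x0 yx].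
by exists x; rewrite ?eqmx_opp // mulmxN x0 oppr0.
Qed.

Program Definition csum (X Y : cpx) : cpx :=
  @Cpx (fun n => rsum (X n) (Y n))
       (fun n => rblock (cd X n) (rzero _ _) (cd Y n)) _ _.
Next Obligation.
move=> X Y n v /=.
by rewrite mulmx_block !cdd !(mul0mx, mulmx0, addr0) block_mx0.
Qed.
Next Obligation.
move=> X Y; have [N HN] := cbd X; have [M HM] := cbd Y.
by exists (maxn N M) => n; rewrite gtn_max => /andP[Nn Mn] v /=; rewrite HN ?HM.
Qed.

(* Cone(f)^n = X^(n+1) + Y^n with d(x, y) = (- d x, f x + d y) *)
Program Definition cone (X Y : cpx) (f : cmap X Y) : cpx :=
  @Cpx (fun n => rsum (X (n + 1)) (Y n))
       (fun n => rblock (ropp (cd X (n + 1))) (f (n + 1)) (cd Y n)) _ _.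
Next Obligation.
move=> X Y f n v /=.
rewrite mulmx_block !(mulmxN, mulNmx) opprK !cdd cmorP addNr.
by rewrite !(mul0mx, mulmx0, oppr0, addr0) block_mx0.
Qed.
Next Obligation.
move=> X Y f; have [N HN] := cbd (shift X); have [M HM] := cbd Y.
exists (maxn N M) => n; rewrite gtn_max => /andP[Nn Mn] v /=.
by have /= -> := HN _ Nn v; rewrite HM.
Qed.

Program Definition rinr (M N : rep) : rhom N (rsum M N) :=
  @RHom N (rsum M N) (fun v => row_mx 0 1%:M) _.
Next Obligation.
move=> M N a /=; rewrite mul_row_block mul_mx_row.
by rewrite !(mul0mx, mulmx0, mul1mx, mulmx1, add0r).
Qed.

Program Definition rfst (M N : rep) : rhom (rsum M N) M :=
  @RHom (rsum M N) M (fun v => col_mx 1%:M 0) _.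
Next Obligation.
move=> M N a /=; rewrite mul_block_col mul_col_mx.
by rewrite !(mul0mx, mulmx0, mul1mx, mulmx1, addr0).
Qed.

Program Definition cone_in (X Y : cpx) (f : cmap X Y) : cmap Y (cone f) :=
  @CMap Y (cone f) (fun n => rinr (X (n + 1)) (Y n)) _.
Next Obligation.
move=> X Y f n v /=; rewrite mul_row_block mul_mx_row.
by rewrite !(mul0mx, mulmx0, mul1mx, mulmx1, add0r).
Qed.

Program Definition cone_out (X Y : cpx) (f : cmap X Y) :
    cmap (cone f) (shift X) :=
  @CMap (cone f) (shift X) (fun n => rfst (X (n + 1)) (Y n)) _.
Next Obligation.
move=> X Y f n v /=; rewrite mul_block_col mul_col_mx.
by rewrite !(mul0mx, mulmx0, mul1mx, mulmx1, addr0).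
Qed.

(* The derived category is the localization C^b(rep)[qis^-1] in the sense of
   Gabriel-Zisman: its morphisms are the formal composites of chain maps and
   inverses of quasi-isomorphisms, and [deq] is equality of morphisms, i.e. the
   smallest congruence making chain maps functorial and the formal inverses
   inverse. *)
Inductive dmor : cpx -> cpx -> Type :=
| Dmap X Y (f : cmap X Y) : dmor X Y
| Dinv X Y (s : cmap X Y) (_ : qis s) : dmor Y X
| Dcomp X Y Z (g : dmor Y Z) (f : dmor X Y) : dmor X Z.

Definition Did (X : cpx) : dmor X X := Dmap (cidmap X).

Inductive deq : forall X Y, dmor X Y -> dmor X Y -> Prop :=
| deq_refl X Y (f : dmor X Y) : deq f f
| deq_sym X Y (f g : dmor X Y) : deq f g -> deq g f
| deq_trans X Y (f g h : dmor X Y) : deq f g -> deq g h -> deq f h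
| deq_congr X Y Z (g g' : dmor Y Z) (f f' : dmor X Y) :
    deq g g' -> deq f f' -> deq (Dcomp g f) (Dcomp g' f')
| deq_assoc X Y Z T (h : dmor Z T) (g : dmor Y Z) (f : dmor X Y) :
    deq (Dcomp h (Dcomp g f)) (Dcomp (Dcomp h g) f)
| deq_idl X Y (f : dmor X Y) : deq (Dcomp (Did Y) f) f
| deq_idr X Y (f : dmor X Y) : deq (Dcomp f (Did X)) f
| deq_map X Y Z (g : cmap Y Z) (f : cmap X Y) :
    deq (Dmap (ccomp g f)) (Dcomp (Dmap g) (Dmap f))
| deq_invl X Y (s : cmap X Y) (qs : qis s) :
    deq (Dcomp (Dinv qs) (Dmap s)) (Did X)
| deq_invr X Y (s : cmap X Y) (qs : qis s) :
    deq (Dcomp (Dmap s) (Dinv qs)) (Did Y).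

Fixpoint Dshift (X Y : cpx) (f : dmor X Y) : dmor (shift X) (shift Y) :=
  match f with
  | Dmap _ _ f => Dmap (shift_map f)
  | Dinv _ _ _ qs => Dinv (shift_qis qs)
  | Dcomp _ _ _ g f => Dcomp (Dshift g) (Dshift f)
  end.

Definition Diso (X Y : cpx) (f : dmor X Y) : Prop :=
  exists g : dmor Y X, deq (Dcomp g f) (Did X) /\ deq (Dcomp f g) (Did Y).

Definition isomorphic (X Y : cpx) : Prop := exists f : dmor X Y, Diso f.

Definition Dhom0 (X Y : cpx) : Prop :=
  forall f : dmor X Y, deq f (Dmap (czero X Y)).

Definition is_zero (X : cpx) : Prop := deq (Did X) (Dmap (czero X X)).

(* A -u-> B -v-> C -w-> A[1] is isomorphic to the triangle of a mapping cone. *)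
Definition exact_triangle (A B C : cpx)
    (u : dmor A B) (v : dmor B C) (w : dmor C (shift A)) : Prop :=
  exists (X Y : cpx) (f : cmap X Y)
         (a : dmor X A) (b : dmor Y B) (c : dmor (cone f) C),
    [/\ Diso a, Diso b & Diso c] /\
    [/\ deq (Dcomp u a) (Dcomp b (Dmap f)),
        deq (Dcomp v b) (Dcomp c (Dmap (cone_in f))) &
        deq (Dcomp w c) (Dcomp (Dshift a) (Dmap (cone_out f)))].

Definition stalk_ob (M : rep) (n : int) : rep :=
  if n is Posz 0 then M else rep0.

Program Definition stalk (M : rep) : cpx :=
  @Cpx (stalk_ob M) (fun n => rzero _ _) _ _.
Next Obligation. by move=> M n v /=; rewrite mul0mx. Qed.
Next Obligation.
by move=> M; exists 0%N => -[[|n]|n].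
Qed.

(* The class in the Grothendieck group, identified with Z^2 through the basis
   [S_1], [S_2]: the alternating sum of the dimension vectors of the terms. *)
Definition K0class (X : cpx) : 'rV[int]_2 :=
  \row_v \sum_(n \in [set: int]) (-1) ^+ `|n|%N * (X n v)%:Z.

End Kronecker.

Section Stability.
Context {R : realType} (l : nat).

Local Notation C := R[i].
Local Notation obj := (cpx C l).

Definition expi (t : R) : C := Complex (cos t) (sin t).

Definition expC (z : C) : C := (expR (complex.Re z))%:C%C * expi (complex.Im z).

Lemma normc_polar (r t : R) : 0 < r -> normc (r%:C%C * expi t) = r.
Proof.
move=> r0; rewrite normcM /= expr0n /= addr0 sqrtr_sqr cos2Dsin2 sqrtr1 mulr1.
by rewrite gtr0_norm.
Qed.

Lemma expiD (t u : R) : expi (t + u) = expi t * expi u.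
Proof.
by apply/eqP; rewrite eq_complex /= cosD sinD eqxx /= addrC.
Qed.

Lemma expC_rot (lam : C) :
  expC (- Complex 0 pi * lam) =
  (expR (pi * complex.Im lam))%:C%C * expi (- (pi * complex.Re lam)).
Proof.
by case: lam => a b; rewrite /expC /= oppr0 !mul0r sub0r add0r !mulNr opprK.
Qed.

Lemma normc_expC_rot (lam : C) :
  normc (expC (- Complex 0 pi * lam)) = expR (pi * complex.Im lam).
Proof. by rewrite expC_rot normc_polar// expR_gt0. Qed.

Definition is_norm (N : 'rV[R]_2 -> R) : Prop :=
  [/\ forall x y, N (x + y) <= N x + N y,
      forall a x, N (a *: x) = `|a| * N x &
      forall x, N x = 0 -> x = 0].

Record HN (P : R -> set obj) (E : obj) := MkHN {
  hn_len : nat;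
  hn_obj : nat -> obj;
  hn_fac : nat -> obj;
  hn_phase : nat -> R;
  hn_start : is_zero (hn_obj 0);
  hn_end : hn_obj hn_len = E;
  hn_triangle : forall i, (i < hn_len)%N ->
    exists (u : dmor (hn_obj i) (hn_obj i.+1))
           (v : dmor (hn_obj i.+1) (hn_fac i))
           (w : dmor (hn_fac i) (shift (hn_obj i))), exact_triangle u v w;
  hn_fac_neq0 : forall i, (i < hn_len)%N -> ~ is_zero (hn_fac i);
  hn_facP : forall i, (i < hn_len)%N -> P (hn_phase i) (hn_fac i);
  hn_decr : forall i j, (i < j)%N -> (j < hn_len)%N ->
    hn_phase j < hn_phase i }.

(* A full subcategory is a set of objects closed under isomorphism. *)
Record stab (nrm : 'rV[R]_2 -> R) := Stab {
  charge : {additive 'rV[int]_2 -> C};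
  slice : R -> set obj;
  slice_iso : forall phi E F, isomorphic E F -> slice phi E -> slice phi F;
  slice0 : forall phi E, is_zero E -> slice phi E;
  slice_sum : forall phi E F,
    slice phi E -> slice phi F -> slice phi (csum E F);
  slice_charge : forall phi E, ~ is_zero E -> slice phi E ->
    exists2 r : R, 0 < r & charge (K0class E) = r%:C%C * expi (pi * phi);
  slice_shift : forall phi E,
    slice (phi + 1) E <-> exists2 F, slice phi F & isomorphic E (shift F);
  slice_hom0 : forall phi1 phi2 E1 E2, phi2 < phi1 ->
    slice phi1 E1 -> slice phi2 E2 -> Dhom0 E1 E2;
  slice_HN : forall E, ~ is_zero E -> inhabited (HN slice E);
  slice_support : exists2 c : R, 0 < c &
    forall phi E, ~ is_zero E -> slice phi E ->
      nrm (map_mx intr (K0class E)) < c * normc (charge (K0class E)) }.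

Section Metric.
Context {nrm : 'rV[R]_2 -> R}.
Implicit Types s t : stab nrm.

Definition hn_mass s (E : obj) (h : HN (slice s) E) : R :=
  \sum_(i < hn_len h) normc (charge s (K0class (hn_fac h i))).

(* HN filtrations are unique up to isomorphism, so the values below do not
   depend on the filtration picked by [xget]. *)
Definition phase_max s (E : obj) : R :=
  xget 0 [set hn_phase h 0%N | h in [set: HN (slice s) E]].

Definition phase_min s (E : obj) : R :=
  xget 0 [set hn_phase h (hn_len h).-1 | h in [set: HN (slice s) E]].

Definition mass s (E : obj) : R :=
  xget 0 [set hn_mass h | h in [set: HN (slice s) E]].

Definition dB s t : \bar R :=
  ereal_sup [set x | exists2 E : obj, ~ is_zero E &
    [\/ x = `|phase_max s E - phase_max t E|%:E,
        x = `|phase_min s E - phase_min t E|%:E |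
        x = `|ln (mass s E / mass t E)|%:E]].

Lemma mass_gt0 s (E : obj) : ~ is_zero E -> 0 < mass s E.
Proof.
move=> E0; rewrite /mass; case: xgetP => [_ _ [h _ <-]|noh]; last first.
  by have [h] := slice_HN s E0; case: (noh (hn_mass h)); exists h.
have Z0 i : (i < hn_len h)%N -> 0 < normc (charge s (K0class (hn_fac h i))).
  move=> il; have [r r0 ->] := slice_charge (hn_fac_neq0 il) (hn_facP il).
  by rewrite normc_polar.
rewrite /hn_mass; case: (hn_len h) (hn_end h) Z0 => [E_|n _ Z0].
  by case: E0; rewrite -E_; exact: hn_start.
rewrite big_ord_recl ltr_pwDl ?Z0//.
by apply: sumr_ge0 => i _; rewrite ltW// Z0.
Qed.

Lemma dB_refl s : (dB s s <= 0)%E.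
Proof.
apply: ge_ereal_sup => _ [E E0 [->|->|->]]; rewrite ?subrr ?normr0//.
by rewrite divff ?ln1 ?normr0// gt_eqF// mass_gt0.
Qed.

Lemma dB_sym s t : dB s t = dB t s.
Proof.
congr ereal_sup; apply/seteqP; split=> x [E E0 [->|->|->]]; exists E => //.
- by apply: Or31; rewrite distrC.
- by apply: Or32; rewrite distrC.
- by apply: Or33; rewrite -invf_div lnV ?normrN// posrE divr_gt0// mass_gt0.
- by apply: Or31; rewrite distrC.
- by apply: Or32; rewrite distrC.
- by apply: Or33; rewrite -invf_div lnV ?normrN// posrE divr_gt0// mass_gt0.
Qed.

Lemma dB_triangle s t u : (dB s u <= dB s t + dB t u)%E.
Proof.
apply: ge_ereal_sup => _ [E E0 [->|->|->]].
- apply: (@le_trans _ _ (`|phase_max s E - phase_max t E|%:E +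
                         `|phase_max t E - phase_max u E|%:E)%E).
    by rewrite -EFinD lee_fin ler_distD.
  by apply: leeD; apply: ereal_sup_ubound; exists E => //; apply: Or31.
- apply: (@le_trans _ _ (`|phase_min s E - phase_min t E|%:E +
                         `|phase_min t E - phase_min u E|%:E)%E).
    by rewrite -EFinD lee_fin ler_distD.
  by apply: leeD; apply: ereal_sup_ubound; exists E => //; apply: Or32.
- apply: (@le_trans _ _ (`|ln (mass s E / mass t E)|%:E +
                         `|ln (mass t E / mass u E)|%:E)%E); last first.
    by apply: leeD; apply: ereal_sup_ubound; exists E => //; apply: Or33.
  have [ms mt mu] := And3 (mass_gt0 s E0) (mass_gt0 t E0) (mass_gt0 u E0).
  rewrite -EFinD lee_fin (le_trans _ (ler_normD _ _))//.
  rewrite -lnM ?posrE ?divr_gt0// mulrA divfK// gt_eqF//.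
Qed.

Definition dB_ball s (e : R) : set (stab nrm) := [set t | (dB s t < e%:E)%E].

Lemma dB_ball_center s (e : R) : 0 < e -> dB_ball s e s.
Proof. by move=> e0; rewrite /dB_ball /= (le_lt_trans (dB_refl s)) ?lte_fin. Qed.

Lemma dB_ball_sym s t (e : R) : dB_ball s e t -> dB_ball t e s.
Proof. by rewrite /dB_ball /= dB_sym. Qed.

Lemma dB_ball_triangle s t u (e1 e2 : R) :
  dB_ball s e1 t -> dB_ball t e2 u -> dB_ball s (e1 + e2) u.
Proof.
rewrite /dB_ball /= => h1 h2; rewrite (le_lt_trans (dB_triangle s t u))//.
by rewrite EFinD lteD.
Qed.

HB.instance Definition _ := gen_eqMixin (stab nrm).
HB.instance Definition _ := gen_choiceMixin (stab nrm).
HB.instance Definition _ :=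
  hasNbhs.Build (stab nrm) (nbhs_ (entourage_ dB_ball)).
HB.instance Definition _ := Nbhs_isPseudoMetric.Build R (stab nrm)
  erefl dB_ball_center dB_ball_sym dB_ball_triangle erefl.

Section Action.
Variables (s : stab nrm) (lam : C).

Definition act_charge : {additive 'rV[int]_2 -> C} :=
  expC (- Complex 0 pi * lam) \*o charge s.
Definition act_slice (phi : R) : set obj := slice s (phi + complex.Re lam).

Lemma actP_charge phi E : ~ is_zero E -> act_slice phi E ->
  exists2 r : R, 0 < r & act_charge (K0class E) = r%:C%C * expi (pi * phi).
Proof.
move=> E0 PE; have [r r0 Er] := slice_charge E0 PE.
exists (expR (pi * complex.Im lam) * r); first by rewrite mulr_gt0 ?expR_gt0.
rewrite /act_charge /= Er expC_rot mulrACA -rmorphM -expiD; congr (_ * expi _).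
by rewrite mulrDr addrCA addNr addr0.
Qed.

Lemma actP_shift phi E :
  act_slice (phi + 1) E <-> exists2 F, act_slice phi F & isomorphic E (shift F).
Proof. by rewrite /act_slice addrAC; exact: slice_shift. Qed.

Lemma actP_hom0 phi1 phi2 E1 E2 : phi2 < phi1 -> act_slice phi1 E1 -> act_slice phi2 E2 ->
  Dhom0 E1 E2.
Proof. by move=> lt12; apply: slice_hom0; rewrite ltrD2r. Qed.

Lemma actP_HN E : ~ is_zero E -> inhabited (HN act_slice E).
Proof.
move=> /(slice_HN s) [[n F A ph H0 H1 H2 H3 H4 H5]]; split.
apply: (@MkHN act_slice E n F A (fun i => ph i - complex.Re lam)) => //.
  by move=> i il; rewrite /act_slice subrK; exact: H4.
by move=> i j ij jn; rewrite ltrD2r H5.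
Qed.

Lemma actP_support : exists2 c : R, 0 < c &
  forall phi E, ~ is_zero E -> act_slice phi E ->
    nrm (map_mx intr (K0class E)) < c * normc (act_charge (K0class E)).
Proof.
have [c c0 sc] := slice_support s.
exists (c / expR (pi * complex.Im lam)); first by rewrite divr_gt0 ?expR_gt0.
move=> phi E E0 PE; rewrite /act_charge /= normcM normc_expC_rot mulrA divfK.
  exact: sc PE.
by rewrite gt_eqF ?expR_gt0.
Qed.

Definition act : stab nrm := @Stab nrm act_charge act_slice
  (fun phi => @slice_iso _ s _) (fun phi => @slice0 _ s _)
  (fun phi => @slice_sum _ s _) actP_charge actP_shift actP_hom0 actP_HN actP_support.

End Action.

Definition Hminus : set C :=
  [set z | exists r phi : R, [/\ 0 < r, 0 < phi <= 1 &
                                 z = r%:C%C * expi (pi * phi)]].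

(* the argument in (0, pi] of an element of Hminus *)
Definition arg (z : C) : R :=
  xget 0 [set a | 0 < a <= pi /\ exists2 r : R, 0 < r & z = r%:C%C * expi a].

Definition rep_neq0 (M : rep C l) : Prop := exists v, (0 < M v)%N.

Definition rmono (A M : rep C l) (i : rhom A M) : Prop :=
  forall v, row_free (i v).

(* nonzero semistable modules of phase phi; a submodule is given by a
   monomorphism *)
Definition semistable (Z : 'rV[int]_2 -> C) (phi : R) (M : rep C l) : Prop :=
  [/\ rep_neq0 M, phi = arg (Z (K0class (stalk M))) / pi &
      forall (A : rep C l) (i : rhom A M), rep_neq0 A -> rmono i ->
        arg (Z (K0class (stalk A))) <= arg (Z (K0class (stalk M)))].

(* s = (Z, mod CK_l); its slices of phase outside (0, 1] are determined by
   [slice_shift]. *)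
Definition standard s : Prop :=
  [/\ forall i : 'I_2, Hminus (charge s (K0class (stalk (simple C l i)))) &
      forall phi, 0 < phi <= 1 -> forall E,
        slice s phi E <->
        is_zero E \/
        exists2 M, semistable (charge s) phi M & isomorphic E (stalk M)].

(* The standard stability conditions form a connected set, so this is a single
   connected component. *)
Definition stab_dagger : set (stab nrm) :=
  [set s | exists2 s0, standard s0 & connected_component setT s0 s].

Definition orbit s : set (stab nrm) := range (act s).

Definition stab_quot : Type :=
  {O : set (stab nrm) | exists2 s, stab_dagger s & O = orbit s}.

Definition orbit_repr (O : stab_quot) : stab nrm :=
  s2val (cid2 (proj2_sig O)).

(* [dB] is invariant under [act], so this does not depend on the choice of
   representatives; it is finite on a connected component. *)
Definition dB_quot (O O' : stab_quot) : R :=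
  fine (ereal_inf
    [set dB (orbit_repr O) (act (orbit_repr O') lam) | lam in [set: C]]).

End Metric.
End Stability.

Section CAT0.
Context {R : realType} {X : Type} (d : X -> X -> R).

(* gamma only matters on [0, 1] *)
Definition geodesic (x y : X) (gamma : R -> X) : Prop :=
  [/\ gamma 0 = x, gamma 1 = y,
      forall t, 0 <= t <= 1 -> forall eps, 0 < eps -> exists2 delta, 0 < delta &
        forall u, 0 <= u <= 1 -> `|u - t| < delta -> d (gamma u) (gamma t) < eps &
      forall t u, 0 <= t <= 1 -> 0 <= u <= 1 ->
        d (gamma t) (gamma u) = d x y * `|t - u|].

Definition geodesic_space : Prop :=
  forall x y, x <> y -> exists gamma, geodesic x y gamma.

Definition eucl (p q : R * R) : R :=
  Num.sqrt ((p.1 - q.1) ^+ 2 + (p.2 - q.2) ^+ 2).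

Definition segment (p q : R * R) (t : R) : R * R :=
  ((1 - t) * p.1 + t * q.1, (1 - t) * p.2 + t * q.2).

(* p' is the comparison point of the point p of the geodesic gamma, whose
   comparison segment is [a, b] *)
Definition comparison (gamma : R -> X) (a b : R * R) (p : X) (p' : R * R) :
    Prop :=
  exists2 t, 0 <= t <= 1 & p = gamma t /\ p' = segment a b t.

Definition CAT0 : Prop :=
  geodesic_space /\
  forall (x y z : X) (gxy gyz gzx : R -> X),
    geodesic x y gxy -> geodesic y z gyz -> geodesic z x gzx ->
  forall a b c : R * R,
    eucl a b = d x y -> eucl b c = d y z -> eucl c a = d z x ->
  let on_triangle p p' :=
    [\/ comparison gxy a b p p', comparison gyz b c p p' |
        comparison gzx c a p p'] in
  forall p p' q q', on_triangle p p' -> on_triangle q q' -> d p q <= eucl p' q'.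

End CAT0.

(* Main.v *)
From HB Require Import structures.
From mathcomp Require Import all_boot all_order all_algebra.
From mathcomp Require Import complex zify ring lra.
From mathcomp Require Import all_classical all_reals all_analysis.
From Corelib Require Setoid Morphisms.
Require Import Defs.

(* If phi(S_1) < phi(S_2) < phi(S_1) + 1, the only stable objects are the shifts
   of S_1 and S_2, and the Harder-Narasimhan factors of a complex E are the
   pieces H^j(E)_v of its cohomology at the two vertices. Hence phases and masses
   of all objects are determined by phi(S_v) and |Z(S_v)|, and modulo the action
   of C the metric on this chamber is half of the sup metric of R^2 in the
   coordinates x = phi(S_2) - phi(S_1), y = log |Z(S_2)| - log |Z(S_1)|. The sup
   metric has pairs of points joined by two different geodesics, which is
   impossible in a CAT(0) space.

   All of this happens among the standard stability conditions, for which the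
   Harder-Narasimhan axioms are checked through cohomology: triangles whose
   connecting maps vanish have additive cohomology, and Hom(X, Y) = 0 when X has
   no cohomology above degree j, Y none below j, and the two degree j parts have
   disjoint supports, because a morphism X -> Y then factors through H^j. *)

(** All arrows end at vertex 2, so S_2 embeds in every representation that is nonzero there. This is
    why phi(S_1) < phi(S_2) destabilizes each representation supported at both vertices. The bound
    phi(S_2) < phi(S_1) + 1 keeps the shifts interleaved: by decreasing phase they read ..., S_2[1],
    S_1[1], S_2, S_1, S_2[-1], ...

    Two features of the definitions shape the proof. Morphisms of the derived category are formal
    words in chain maps and inverted quasi-isomorphisms, so facts about them go by induction on
    words, each word being sent functorially to cohomology or to truncations. Extreme phases, masses
    and orbit representatives are chosen values, so every formula is proved for an arbitrary
    filtration and an arbitrary representative.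

    The factor one half is the effect of recentring: an element of C moves both phases, or both
    logarithmic masses, by a common amount, and the best choice leaves half the difference of the
    two displacements. The contradiction uses a triangle with a repeated vertex, whose two long
    sides are distinct geodesics. *)

Set Implicit Arguments.
Unset Strict Implicit.
Unset Printing Implicit Defensive.

Import Order.TTheory GRing.Theory Num.Theory.
Import Normc.

Local Open Scope ring_scope.

(** * Subquotients of row spaces *)

(* Coordinates on the subquotient Z / B of a row space, identified with a
   complement of B in Z. *)
Definition sqdim {K : fieldType} {n : nat} (Z B : 'M[K]_n) : nat :=
  \rank (Z :\: B)%MS.

HB.lock Definition sqin {K : fieldType} {n : nat} (Z B : 'M[K]_n) :
  'M[K]_(sqdim Z B, n) := row_base (Z :\: B)%MS.

(** Projection along B onto the complement, then coordinates there. It is a matrix on the whole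
    ambient space, so induced maps on subquotients are plain matrix products. *)
HB.lock Definition sqout {K : fieldType} {n : nat} (Z B : 'M[K]_n) :
    'M[K]_(n, sqdim Z B) :=
  proj_mx (Z :\: B)%MS B *m pinvmx (row_base (Z :\: B)%MS).

Section Subquotient.
Context {K : fieldType}.

Section Def.
Context {n : nat} {Z B : 'M[K]_n}.

Lemma sqinS : (sqin Z B <= Z)%MS.
Proof. by rewrite sqin.unlock (submx_trans _ (diffmxSl Z B)) ?eq_row_base. Qed.

Lemma sqinK : sqin Z B *m sqout Z B = 1%:M.
Proof.
rewrite sqout.unlock sqin.unlock mulmxA proj_mx_id ?capmx_diff ?eq_row_base //.
by rewrite mulmxVp ?row_base_free.
Qed.

Lemma sqout0 m (x : 'M[K]_(m, n)) : (x <= B)%MS -> x *m sqout Z B = 0.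
Proof. by move=> xB; rewrite sqout.unlock mulmxA proj_mx_0 ?mul0mx ?capmx_diff. Qed.

Lemma sqdim_le : (sqdim Z B <= n)%N.
Proof. exact: rank_leq_col. Qed.

Lemma sqoutK m (x : 'M[K]_(m, n)) :
  (x <= Z)%MS -> (x - x *m sqout Z B *m sqin Z B <= B)%MS.
Proof.
move=> xZ; rewrite sqout.unlock sqin.unlock (mulmxA x) mulmxKpV; last first.
  by rewrite eq_row_base proj_mx_sub.
apply: proj_mx_compl_sub; rewrite (submx_trans xZ) //.
by rewrite -(addsmx_diff_cap_eq Z B) addsmxS // capmxSr.
Qed.

Lemma sqdimE : (B <= Z)%MS -> (sqdim Z B + \rank B = \rank Z)%N.
Proof. by move=> BZ; rewrite -(mxrank_cap_compl Z B) (capmx_idPr BZ) addnC. Qed.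

End Def.

Context {n1 n2 n3 : nat} (Z1 B1 : 'M[K]_n1) (Z2 B2 : 'M[K]_n2)
  (Z3 B3 : 'M[K]_n3).

Definition sqmap (f : 'M[K]_(n1, n2)) : 'M[K]_(sqdim Z1 B1, sqdim Z2 B2) :=
  sqin Z1 B1 *m f *m sqout Z2 B2.

(** The representative chosen midway is off by an element of [B2], which [g] sends into [B3], where
    [sqout] kills it. *)
Lemma sqmapM (f : 'M[K]_(n1, n2)) (g : 'M[K]_(n2, n3)) :
  (Z1 *m f <= Z2)%MS -> (B2 *m g <= B3)%MS ->
  sqmap f *m (sqin Z2 B2 *m g *m sqout Z3 B3) =
  sqin Z1 B1 *m (f *m g) *m sqout Z3 B3.
Proof.
move=> fZ gB; apply/eqP; rewrite eq_sym -subr_eq0 /sqmap !mulmxA -!mulmxBl.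
apply/eqP; apply: sqout0; rewrite (submx_trans _ gB) // submxMr // sqoutK //.
by rewrite (submx_trans _ fZ) // submxMr // sqinS.
Qed.

End Subquotient.

Section Kronecker.
Context {K : fieldType} {l : nat}.
Implicit Types (M N P : rep K l) (X Y W : cpx K l).

Lemma rhom_eq M N (f g : rhom M N) : (forall v, f v = g v) -> f = g.
Proof.
case: f g => [f fP] [g gP] /= fg; have {}fg: f = g by apply: functional_extensionality_dep.
by rewrite fg in fP *; congr RHom; apply: Prop_irrelevance.
Qed.

Lemma cmap_eq X Y (f g : cmap X Y) : (forall n v, f n v = g n v) -> f = g.
Proof.
case: f g => [f fP] [g gP] /= fg.
have {}fg: f = g by apply: functional_extensionality_dep => n; apply: rhom_eq.
by rewrite fg in fP *; congr CMap; apply: Prop_irrelevance.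
Qed.
End Kronecker.

(** * Cohomology as an invariant of the derived category *)

Section Kronecker.
Context {K : fieldType} {l : nat}.
Implicit Types (M N P : rep K l) (X Y W : cpx K l).

#[export] Instance deq_equiv X Y : RelationClasses.Equivalence (@deq K l X Y).
Proof.
by split=> [f|f g|f g h]; [exact: deq_refl|exact: deq_sym|exact: deq_trans].
Qed.

#[export] Instance Dcomp_proper X Y W :
  Morphisms.Proper (Morphisms.respectful (@deq K l Y W)
    (Morphisms.respectful (@deq K l X Y) (@deq K l X W))) (@Dcomp K l X Y W).
Proof. by move=> g g' gg f f' ff; apply: deq_congr. Qed.

Lemma Diso_id X : Diso (Did X).
Proof. by exists (Did X); split; rewrite deq_idl; reflexivity. Qed.

Lemma Diso_comp X Y W (g : dmor Y W) (f : dmor X Y) :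
  Diso g -> Diso f -> Diso (Dcomp g f).
Proof.
move=> [g' [g1 g2]] [f' [f1 f2]]; exists (Dcomp f' g'); split.
  by rewrite -deq_assoc [Dcomp g' _]deq_assoc g1 deq_idl.
by rewrite -deq_assoc [Dcomp f _]deq_assoc f2 deq_idl.
Qed.

Lemma qis_Diso X Y (s : cmap X Y) : qis s -> Diso (Dmap s).
Proof.
by move=> qs; exists (Dinv qs); split; [exact: deq_invl|exact: deq_invr].
Qed.

Lemma isomorphic_sym X Y : isomorphic X Y -> isomorphic Y X.
Proof. by move=> [f [g [fg gf]]]; exists g, f. Qed.

Lemma isomorphic_trans X Y W :
  isomorphic X Y -> isomorphic Y W -> isomorphic X W.
Proof. by move=> [f fi] [g gi]; exists (Dcomp g f); exact: Diso_comp. Qed.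

Lemma qis_isomorphic X Y (s : cmap X Y) : qis s -> isomorphic X Y.
Proof. by exists (Dmap s); exact: qis_Diso. Qed.

(** Index n stands for degree n + 1: the differential out of n lands there on the nose, whereas
    degree n itself would need a transport along n - 1 + 1 = n. *)
Definition cocyc X (n : int) v : 'M[K]_(X (n + 1) v) := kermx (cd X (n + 1) v).
Definition cobd X (n : int) v : 'M[K]_(X (n + 1) v) := <<cd X n v>>%MS.

Lemma cobdS X (n : int) v : (cobd X n v <= cocyc X n v)%MS.
Proof. by rewrite genmxE; apply/sub_kermxP; exact: cdd. Qed.

(* dimension at the vertex v of the cohomology in degree n + 1 *)
Definition hdim X (n : int) v : nat := sqdim (cocyc X n v) (cobd X n v).

(** Rank-nullity, kept free of subtraction so that later dimension counts close by linear
    arithmetic. *)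
Lemma hdimE X (n : int) v :
  (hdim X n v + \rank (cd X n v) + \rank (cd X (n + 1) v))%N = X (n + 1) v.
Proof.
have := sqdimE (cobdS X n v); rewrite /hdim mxrank_gen mxrank_ker => ->.
by rewrite subnK // rank_leq_row.
Qed.

Lemma hdim_le X (n : int) v : (hdim X n v <= X (n + 1)%R v)%N.
Proof. exact: sqdim_le. Qed.

Lemma hdim0P X (n : int) v : hdim X n v = 0%N <->
  forall x : 'rV_(X (n + 1) v), x *m cd X (n + 1) v = 0 -> (x <= cd X n v)%MS.
Proof.
rewrite /hdim; split=> [h0 x /sub_kermxP xZ|h0].
  have := sqoutK (B := cobd X n v) xZ; rewrite genmxE.
  suff -> : x *m sqout (cocyc X n v) (cobd X n v) = 0 by rewrite mul0mx subr0.
  by move: (x *m _); rewrite h0 => ?; rewrite thinmx0.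
have := sqdimE (cobdS X n v); suff -> : \rank (cocyc X n v) = \rank (cobd X n v).
  lia.
apply/eqP; rewrite eqn_leq mxrankS ?mxrankS ?cobdS //.
by rewrite genmxE; apply/rV_subP => x /sub_kermxP; exact: h0.
Qed.

Lemma cmap_cocyc X Y (f : cmap X Y) (n : int) v :
  (cocyc X n v *m f (n + 1)%R v <= cocyc Y n v)%MS.
Proof.
by apply/sub_kermxP; rewrite -mulmxA cmorP mulmxA mulmx_ker mul0mx.
Qed.

Lemma cmap_cobd X Y (f : cmap X Y) (n : int) v :
  (cobd X n v *m f (n + 1)%R v <= cobd Y n v)%MS.
Proof. by rewrite genmxE (eqmxMr _ (genmxE _)) -cmorP submxMl. Qed.

Definition hmap X Y (f : cmap X Y) (n : int) v : 'M[K]_(hdim X n v, hdim Y n v) :=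
  sqmap (cocyc X n v) (cobd X n v) (cocyc Y n v) (cobd Y n v) (f (n + 1) v).

Lemma hmap_id X (n : int) v : hmap (cidmap X) n v = 1%:M.
Proof. by rewrite /hmap /sqmap mulmx1 sqinK. Qed.

Lemma hmap_comp X Y W (g : cmap Y W) (f : cmap X Y) (n : int) v :
  hmap (ccomp g f) n v = hmap f n v *m hmap g n v.
Proof.
rewrite /hmap [in RHS]/sqmap sqmapM //.
  exact: cmap_cocyc.
exact: cmap_cobd.
Qed.

Lemma qis_hmap X Y (s : cmap X Y) (n : int) v :
  qis s -> row_free (hmap s n v) /\ row_full (hmap s n v).
Proof.
move=> /(_ n v) [inj surj]; split.
  apply: inj_row_free => x; rewrite /hmap /sqmap !mulmxA => xf0.
  have xZ : (x *m sqin (cocyc X n v) (cobd X n v) <= cocyc X n v)%MS.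
    exact: submx_trans (submxMl _ _) sqinS.
  have := sqoutK (B := cobd Y n v) (submx_trans (submxMr _ xZ) (cmap_cocyc s n v)).
  rewrite xf0 mul0mx subr0 genmxE => /inj; move/sub_kermxP: xZ => -> //.
  move/(_ erefl); rewrite -(genmxE (cd X n v)) => /(@sqout0 _ _ (cocyc X n v)).
  by rewrite -mulmxA sqinK mulmx1.
rewrite -sub1mx; apply/rV_subP => y _.
have [] := surj (y *m sqin (cocyc Y n v) (cobd Y n v)).
  apply/sub_kermxP; exact: submx_trans (submxMl _ _) sqinS.
move=> x /sub_kermxP xZ yx.
rewrite -[y]mulmx1 -(@sqinK _ _ (cocyc Y n v) (cobd Y n v)) mulmxA.
rewrite -[y *m _](subrK (x *m s (n + 1) v)) mulmxDl sqout0 ?genmxE // add0r.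
rewrite -[x](subrK (x *m sqout (cocyc X n v) (cobd X n v) *m
  sqin (cocyc X n v) (cobd X n v))) 2!mulmxDl sqout0 ?add0r; last first.
  by rewrite (submx_trans _ (cmap_cobd s n v)) // submxMr // sqoutK.
by apply/submxP; exists (x *m sqout _ _); rewrite /hmap /sqmap !mulmxA.
Qed.

(** Cohomology of formal words. By [qis_hmap] the [pinvmx] is a two-sided inverse, as the relations
    [deq_invl] and [deq_invr] require. *)
Fixpoint Dhmap (n : int) v X Y (f : dmor X Y) : 'M[K]_(hdim X n v, hdim Y n v) :=
  match f with
  | Dmap _ _ f => hmap f n v
  | Dinv _ _ s _ => pinvmx (hmap s n v)
  | Dcomp _ _ _ g f => Dhmap n v f *m Dhmap n v g
  end.

Lemma deq_Dhmap (n : int) v X Y (f g : dmor X Y) :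
  deq f g -> Dhmap n v f = Dhmap n v g.
Proof.
elim=> {X Y f g} //=.
- by move=> X Y f g h _ -> _ ->.
- by move=> X Y W g g' f f' _ -> _ ->.
- by move=> X Y W T h g f; rewrite mulmxA.
- by move=> X Y f; rewrite hmap_id mulmx1.
- by move=> X Y f; rewrite hmap_id mul1mx.
- by move=> X Y W g f; rewrite hmap_comp.
- by move=> X Y s qs; rewrite hmap_id mulmxVp // (qis_hmap _ _ qs).1.
- by move=> X Y s qs; rewrite hmap_id mulVpmx // (qis_hmap _ _ qs).2.
Qed.

Lemma isomorphic_hdim X Y (n : int) v : isomorphic X Y -> hdim X n v = hdim Y n v.
Proof.
move=> [f [g [/(deq_Dhmap n v) /= gf /(deq_Dhmap n v) /= fg]]].
rewrite !hmap_id in fg gf.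
by apply/eqP; rewrite eqn_leq (mulmx1_min fg) (mulmx1_min gf).
Qed.

Lemma deq_eq X Y (f g : cmap X Y) : f = g -> deq (Dmap f) (Dmap g).
Proof. by move=> ->; exact: deq_refl. Qed.

Lemma Dcomp0l X Y W (f : dmor X Y) :
  deq (Dcomp (Dmap (czero Y W)) f) (Dmap (czero X W)).
Proof.
elim: f W => {X Y} [X Y f|X Y s qs|X Y T g IHg f IHf] W.
- rewrite -deq_map; apply: deq_eq; apply: cmap_eq => n v /=.
  by rewrite mulmx0.
- suff -> : czero X W = ccomp (czero Y W) s.
    by rewrite deq_map -deq_assoc deq_invr deq_idr; reflexivity.
  by apply: cmap_eq => n v /=; rewrite mulmx0.
- by rewrite deq_assoc IHg IHf; reflexivity.
Qed.

(** For the converse, the zero endomorphism of an acyclic complex is a quasi-isomorphism; being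
    invertible and idempotent, it is the identity. *)
Lemma is_zeroP X : is_zero X <-> forall n v, hdim X n v = 0%N.
Proof.
split=> [X0 n v|X0].
  move/(deq_Dhmap n v): X0; rewrite /= hmap_id /hmap /sqmap /=.
  rewrite mulmx0 mul0mx => /(congr1 mxrank); rewrite mxrank1 mxrank0 //.
have q0 : qis (czero X X).
  move=> n v; have /hdim0P h0 := X0 n v; split=> [x /h0 //|y /h0 yd].
  by exists 0; rewrite ?mul0mx // subr0.
have zz : ccomp (czero X X) (czero X X) = czero X X.
  by apply: cmap_eq => n v /=; rewrite mulmx0.
have : deq (Dcomp (Dcomp (Dinv q0) (Dmap (czero X X)))
                  (Dmap (czero X X)))
           (Dcomp (Dinv q0) (Dmap (czero X X))).
  by rewrite -deq_assoc -deq_map zz; reflexivity.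
by rewrite deq_invl deq_idl => zid; exact: deq_sym.
Qed.
End Kronecker.

(** * Subquotient complexes *)

Section Kronecker.
Context {K : fieldType} {l : nat}.
Implicit Types (M N P : rep K l) (X Y W : cpx K l).


(** Transport along an equality of degrees, made a morphism so that it composes with differentials
    as a matrix. *)
Definition ccast X m n (e : m = n) : rhom (X m) (X n) :=
  match e with erefl => rid (X m) end.

Lemma ccast_id X m (e : m = m) : ccast X e = rid (X m).
Proof. by rewrite (eq_irrelevance e erefl). Qed.

Lemma ccast_cd X m n (e : m = n) (e' : m + 1 = n + 1) v :
  cd X m v *m ccast X e' v = ccast X e v *m cd X n v.
Proof.
by case: n / e e' => e'; rewrite !ccast_id mulmx1 mul1mx.
Qed.

Lemma ccast_full X m n (e : m = n) v : row_full (ccast X e v).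
Proof. by case: n / e; rewrite row_full_unit unitmx1. Qed.

(** Unlike [cocyc] and [cobd], indexed by the degree itself, because truncation needs families over
    all degrees; the cast in [imc] disappears through [imcE]. *)
Definition kerc X m v : 'M[K]_(X m v) := kermx (cd X m v).
Definition imc X m v : 'M[K]_(X m v) :=
  <<cd X (m - 1) v *m ccast X (subrK 1 m) v>>%MS.

Lemma imcE X (n : int) v : (imc X (n + 1) v :=: cd X n v)%MS.
Proof.
apply: eqmx_trans (genmxE _) _; set e := subrK 1 (n + 1).
have e1 : n + 1 - 1 = n by rewrite addrK.
rewrite (ccast_cd X e1 e); exact/eqmxMfull/ccast_full.
Qed.

(** Two subcomplexes Z and B of X; [sqcpx] realizes Z modulo its intersection with B. *)
Record subquo X := Subquo {
  sqZ : forall m v, 'M[K]_(X m v);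
  sqB : forall m v, 'M[K]_(X m v);
  sqZarr : forall m a, (sqZ m v1 *m arr (X m) a <= sqZ m v2)%MS;
  sqBarr : forall m a, (sqB m v1 *m arr (X m) a <= sqB m v2)%MS;
  sqZd : forall m v, (sqZ m v *m cd X m v <= sqZ (m + 1)%R v)%MS;
  sqBd : forall m v, (sqB m v *m cd X m v <= sqB (m + 1)%R v)%MS }.

Section SubquoComplex.
Context {X : cpx K l} (s : subquo X).

Definition sqrep m : rep K l :=
  @Rep K l (fun v => sqdim (sqZ s m v) (sqB s m v))
    (fun a => sqmap (sqZ s m v1) (sqB s m v1) (sqZ s m v2) (sqB s m v2)
                    (arr (X m) a)).

Program Definition sqcd m : rhom (sqrep m) (sqrep (m + 1)) :=
  @RHom K l (sqrep m) (sqrep (m + 1))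
    (fun v => sqmap (sqZ s m v) (sqB s m v) (sqZ s (m + 1) v) (sqB s (m + 1) v)
                    (cd X m v)) _.
Next Obligation.
move=> m a /=; rewrite !sqmapM ?sqZd ?sqBd ?sqZarr ?sqBarr //.
by rewrite rmapP.
Qed.

Program Definition sqcpx : cpx K l := @Cpx K l sqrep sqcd _ _.
Next Obligation.
move=> m v /=; rewrite sqmapM ?sqZd ?sqBd // cdd.
by rewrite mulmx0 mul0mx.
Qed.
Next Obligation.
have [N HN] := cbd X; exists N => m Nm v /=.
by apply/eqP; rewrite -leqn0 -(HN m Nm v) sqdim_le.
Qed.

Program Definition sqincl (B0 : forall m v, sqB s m v = 0) : cmap sqcpx X :=
  @CMap K l sqcpx X (fun m => @RHom K l (sqrep m) (X m)
                           (fun v => sqin (sqZ s m v) (sqB s m v)) _) _.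
Next Obligation.
move=> B0 m a /=; rewrite /sqmap; apply/eqP; rewrite eq_sym -subr_eq0 -submx0.
rewrite -(B0 m v2) sqoutK // (submx_trans _ (sqZarr s m a)) //.
by rewrite submxMr ?sqinS.
Qed.
Next Obligation.
move=> B0 m v /=; rewrite /sqmap; apply/eqP; rewrite -subr_eq0 -submx0.
rewrite -(B0 (m + 1) v) sqoutK // (submx_trans _ (sqZd s m v)) //.
by rewrite submxMr ?sqinS.
Qed.

Lemma sq_im m v (x : 'rV_(sqcpx (m + 1) v)) (w : 'rV_(X m v)) :
  (w <= sqZ s m v)%MS ->
  (x *m sqin (sqZ s (m + 1) v) (sqB s (m + 1) v) - w *m cd X m v
     <= sqB s (m + 1)%R v)%MS ->
  (x <= cd sqcpx m v)%MS.
Proof.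
move=> wZ xw; apply/submxP; exists (w *m sqout (sqZ s m v) (sqB s m v)).
rewrite /= /sqmap !mulmxA -[LHS]mulmx1.
rewrite -(@sqinK _ _ (sqZ s (m + 1) v) (sqB s (m + 1) v)) mulmxA.
apply/eqP; rewrite -subr_eq0 -mulmxBl; apply/eqP; apply: sqout0.
rewrite -[X in (X - _)%R](subrK (w *m cd X m v)) -addrA addmx_sub //.
rewrite -mulmxBl (submx_trans _ (sqBd s m v)) // submxMr //.
by rewrite sqoutK.
Qed.

Lemma sq_cyc m v (x : 'rV_(sqcpx m v)) : x *m cd sqcpx m v = 0 ->
  (x *m sqin (sqZ s m v) (sqB s m v) *m cd X m v <= sqB s (m + 1)%R v)%MS.
Proof.
rewrite /= /sqmap !mulmxA => x0.
rewrite -[X in (X <= _)%MS]subr0 -(mul0mx _ (sqin (sqZ s (m + 1) v) (sqB s (m + 1) v))).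
rewrite -x0 sqoutK // (submx_trans _ (sqZd s m v)) // submxMr //.
exact: submx_trans (submxMl _ _) sqinS.
Qed.

End SubquoComplex.

Program Definition sqcmap X Y (s : subquo X) (t : subquo Y) (f : cmap X Y)
    (fZ : forall m v, (sqZ s m v *m f m v <= sqZ t m v)%MS)
    (fB : forall m v, (sqB s m v *m f m v <= sqB t m v)%MS) :
    cmap (sqcpx s) (sqcpx t) :=
  @CMap K l (sqcpx s) (sqcpx t) (fun m => @RHom K l (sqrep s m) (sqrep t m)
    (fun v => sqmap (sqZ s m v) (sqB s m v) (sqZ t m v) (sqB t m v) (f m v)) _) _.
Next Obligation.
by move=> X Y s t f fZ fB m a /=; rewrite !sqmapM ?sqZarr ?sqBarr // rmapP.
Qed.
Next Obligation.
by move=> X Y s t f fZ fB m v /=; rewrite !sqmapM ?sqZd ?sqBd // cmorP.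
Qed.

End Kronecker.

(** * Truncation *)

Section Kronecker.
Context {K : fieldType} {l : nat}.
Implicit Types (M N P : rep K l) (X Y W : cpx K l).


Lemma mul0mxS m1 m2 n p (A : 'M[K]_(n, p)) (B : 'M[K]_(m2, p)) :
  ((0 : 'M[K]_(m1, n)) *m A <= B)%MS.
Proof. by rewrite mul0mx sub0mx. Qed.

(** The boundary layer A is a parameter: [kerc] gives the usual truncation, [imc] the part divided
    out in [stalkH], and [remove_top] mixes the two vertex by vertex. *)
Definition truncmx X (n : int) (A : forall m v, 'M[K]_(X m v)) m v : 'M[K]_(X m v) :=
  if m < n + 1 then 1%:M else if m == n + 1 then A m v else 0.

Lemma truncmx_lt X (n : int) A m v : m < n + 1 -> @truncmx X n A m v = 1%:M.
Proof. by rewrite /truncmx => ->. Qed.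

Lemma truncmx_eq X (n : int) A v : @truncmx X n A (n + 1) v = A (n + 1) v.
Proof. by rewrite /truncmx ltxx eqxx. Qed.

Lemma truncmx_gt X (n : int) A m v : n + 1 < m -> @truncmx X n A m v = 0.
Proof. by rewrite /truncmx => nm; rewrite ltNge ltW //= gt_eqF. Qed.

Record trunc_ok X (n : int) (A : forall m v, 'M[K]_(X m v)) : Prop := TruncOk {
  trok_arr : forall a, (A (n + 1)%R v1 *m arr (X (n + 1)%R) a <= A (n + 1)%R v2)%MS;
  trok_im : forall v, (cd X n v <= A (n + 1)%R v)%MS;
  trok_ker : forall v, A (n + 1) v *m cd X (n + 1) v = 0 }.

Lemma truncmx_arr X (n : int) A : trunc_ok n A ->
  forall m a, (@truncmx X n A m v1 *m arr (X m) a <= @truncmx X n A m v2)%MS.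
Proof.
move=> ok m a; have [mn|nm|->] := ltgtP m (n + 1).
- by rewrite [truncmx _ _ _ v2]truncmx_lt // submx1.
- by rewrite truncmx_gt // mul0mx sub0mx.
- by rewrite !truncmx_eq; apply: trok_arr.
Qed.

Lemma truncmx_cd X (n : int) A : trunc_ok n A ->
  forall m v, (@truncmx X n A m v *m cd X m v <= @truncmx X n A (m + 1)%R v)%MS.
Proof.
move=> ok m v; have [mn|nm|->] := ltgtP m (n + 1).
- have [mn1|nm1|mn1] := ltgtP m n.
  + by rewrite [truncmx _ _ (m + 1) v]truncmx_lt ?submx1 ?ltrD2r.
  + by exfalso; lia.
  + by rewrite mn1 truncmx_eq (submx_trans (submxMl _ _)) // trok_im.
- by rewrite truncmx_gt // mul0mx sub0mx.
- by rewrite truncmx_eq trok_ker ?sub0mx.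
Qed.

Lemma kerc_ok X (n : int) : trunc_ok n (kerc X).
Proof.
split=> [a|v|v]; last exact: mulmx_ker.
  by apply/sub_kermxP; rewrite -mulmxA rmapP mulmxA mulmx_ker mul0mx.
by apply/sub_kermxP; exact: cdd.
Qed.

Lemma imc_ok X (n : int) : trunc_ok n (imc X).
Proof.
split=> [a|v|v].
- by rewrite (eqmxMr _ (imcE X n v1)) imcE -rmapP submxMl.
- by rewrite imcE.
- by apply/eqP; rewrite -submx0 (eqmxMr _ (imcE X n v)) cdd sub0mx.
Qed.

Definition trsub X (n : int) A (ok : @trunc_ok X n A) : subquo X :=
  @Subquo K l X (truncmx n A) (fun m v => 0)
   (truncmx_arr ok) (fun _ _ => mul0mxS _ _ _)
   (truncmx_cd ok) (fun _ _ => mul0mxS _ _ _).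

(* H^(n+1)(X) in degree n + 1, presented as the quotient of the truncation tker by
   everything below degree n + 1, so that tkst below is a chain map. *)
Definition stsub X (n : int) : subquo X :=
  @Subquo K l X (truncmx n (kerc X)) (truncmx n (imc X))
    (truncmx_arr (kerc_ok X n)) (truncmx_arr (imc_ok X n))
    (truncmx_cd (kerc_ok X n)) (truncmx_cd (imc_ok X n)).

Definition trunc X (n : int) A (ok : @trunc_ok X n A) : cpx K l := sqcpx (trsub ok).
Definition trunc_in X (n : int) A (ok : @trunc_ok X n A) : cmap (trunc ok) X :=
  sqincl (s := trsub ok) (fun _ _ => erefl).

(** Injectivity on cohomology: up to degree n + 1 a primitive lives in degree at most n, where the
    truncation is all of X; above, the truncation is zero. *)
Lemma trunc_inj X (n : int) A (ok : @trunc_ok X n A) k v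
    (x : 'rV_(trunc ok (k + 1) v)) :
  (x *m trunc_in ok (k + 1)%R v <= cd X k v)%MS -> (x <= cd (trunc ok) k v)%MS.
Proof.
have [kn|nk] := leP (k + 1) (n + 1); last first.
  move=> _; suff -> : x = 0 by rewrite sub0mx.
  rewrite -[x]mulmx1 -(@sqinK _ _ (truncmx n A (k + 1) v) 0) mulmxA.
  rewrite -[RHS](mul0mx _ (sqout (truncmx n A (k + 1) v) 0)); congr (_ *m _).
  apply/eqP; rewrite -submx0.
  have := @sqinS _ _ (truncmx n A (k + 1) v) 0.
  rewrite [X in (_ <= X)%MS]truncmx_gt //; exact: submx_trans (submxMl _ _).
move=> /submxP[w xw]; apply: (sq_im (w := w)).
  by rewrite /= truncmx_lt ?submx1 //; lia.
by rewrite /= -xw subrr sub0mx.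
Qed.

Lemma trunc_surj X (n : int) A (ok : @trunc_ok X n A) k v
    (y : 'rV_(X (k + 1) v)) :
  (y <= truncmx n A (k + 1)%R v)%MS -> y *m cd X (k + 1) v = 0 ->
  exists2 x : 'rV_(trunc ok (k + 1) v), x *m cd (trunc ok) (k + 1) v = 0 &
    x *m trunc_in ok (k + 1) v = y.
Proof.
move=> yZ y0; exists (y *m sqout (truncmx n A (k + 1) v) 0); last first.
  by apply/esym/eqP; rewrite -subr_eq0 -submx0 sqoutK.
rewrite /= /sqmap !mulmxA.
have -> : y *m sqout (truncmx n A (k + 1) v) 0 *m sqin (truncmx n A (k + 1) v) 0 = y.
  by apply/esym/eqP; rewrite -subr_eq0 -submx0 sqoutK.
by rewrite y0 mul0mx.
Qed.

Definition tker X n := trunc (kerc_ok X n).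
Definition tkin X n : cmap (tker X n) X := trunc_in (kerc_ok X n).
Definition stalkH X n := sqcpx (stsub X n).

Lemma cmap_kerc X Y (f : cmap X Y) m v : (kerc X m v *m f m v <= kerc Y m v)%MS.
Proof. by apply/sub_kermxP; rewrite -mulmxA cmorP mulmxA mulmx_ker mul0mx. Qed.

Lemma cmap_imc X Y (f : cmap X Y) (n : int) v :
  (imc X (n + 1)%R v *m f (n + 1)%R v <= imc Y (n + 1)%R v)%MS.
Proof. by rewrite imcE (eqmxMr _ (imcE _ _ _)) -cmorP submxMl. Qed.

Lemma cmap_truncmx X Y (f : cmap X Y) (n : int)
    (A : forall m v, 'M[K]_(X m v)) (B : forall m v, 'M[K]_(Y m v)) :
  (forall v, (A (n + 1)%R v *m f (n + 1)%R v <= B (n + 1)%R v)%MS) ->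
  forall m v, (@truncmx X n A m v *m f m v <= @truncmx Y n B m v)%MS.
Proof.
move=> AB m v; have [mn|nm|->] := ltgtP m (n + 1).
- by rewrite [X in (_ <= X)%MS]truncmx_lt // submx1.
- by rewrite truncmx_gt // mul0mx sub0mx.
- by rewrite !truncmx_eq.
Qed.

Definition tkmap X Y (f : cmap X Y) n : cmap (tker X n) (tker Y n) :=
  @sqcmap K l X Y (trsub (kerc_ok X n)) (trsub (kerc_ok Y n)) f
   (cmap_truncmx (fun v => cmap_kerc f (n + 1) v))
   (fun _ _ => mul0mxS _ _ _).

Definition stmap X Y (f : cmap X Y) n : cmap (stalkH X n) (stalkH Y n) :=
  @sqcmap K l X Y (stsub X n) (stsub Y n) f
   (cmap_truncmx (fun v => cmap_kerc f (n + 1) v))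
   (cmap_truncmx (fun v => cmap_imc f n v)).

(** With [tkin], this forms the roof from X to its cohomology in degree n + 1. *)
Program Definition tkst X n : cmap (tker X n) (stalkH X n) :=
  @sqcmap K l X X (trsub (kerc_ok X n)) (stsub X n) (cidmap X) _ _.
Next Obligation. by move=> X n m v /=; rewrite mulmx1. Qed.
Next Obligation. by move=> X n m v /=; rewrite mul0mx sub0mx. Qed.

End Kronecker.

(** * Naturality of truncation and vanishing of morphisms *)

Section Kronecker.
Context {K : fieldType} {l : nat}.
Implicit Types (M N P : rep K l) (X Y W : cpx K l).


Lemma sqout0K n (Z : 'M[K]_n) m (x : 'M[K]_(m, n)) :
  (x <= Z)%MS -> x *m sqout Z 0 *m sqin Z 0 = x.
Proof. by move=> xZ; apply/esym/eqP; rewrite -subr_eq0 -submx0 sqoutK. Qed.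

Lemma trunc_cyc X (n : int) A (ok : @trunc_ok K l X n A) m v
    (x : 'rV_(trunc ok m v)) :
  x *m cd (trunc ok) m v = 0 -> x *m trunc_in ok m v *m cd X m v = 0.
Proof. by move=> /sq_cyc /=; rewrite submx0 => /eqP. Qed.

Lemma trunc_inS X (n : int) A (ok : @trunc_ok K l X n A) m v
    (x : 'rV_(trunc ok m v)) :
  (x *m trunc_in ok m v <= truncmx n A m v)%MS.
Proof. exact: submx_trans (submxMl _ _) sqinS. Qed.

Lemma truncmx_ker_cyc X (n k : int) v (y : 'rV_(X (k + 1) v)) :
  k <= n -> y *m cd X (k + 1) v = 0 -> (y <= truncmx n (kerc X) (k + 1)%R v)%MS.
Proof.
move=> kn y0; have [kn1|nk|kn1] := ltgtP k n.
- by rewrite truncmx_lt ?ltrD2r // submx1.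
- by rewrite leNgt nk in kn.
- by move: y y0; rewrite kn1 => y y0; rewrite truncmx_eq; apply/sub_kermxP.
Qed.

Lemma qis_tkin X (n : int) :
  (forall k v, n < k -> hdim X k v = 0%N) -> qis (tkin X n).
Proof.
move=> X0 k v; split=> [x _ xd|y yd]; first exact: (trunc_inj xd).
have [kn|nk] := leP k n.
  have [x x0 xy] := trunc_surj (kerc_ok X n) (truncmx_ker_cyc kn yd) yd.
  by exists x; rewrite // xy subrr sub0mx.
exists 0; rewrite ?mul0mx // subr0.
by have /hdim0P := X0 k v nk; apply.
Qed.

Lemma tkmap_in X Y (f : cmap X Y) n :
  ccomp f (tkin X n) = ccomp (tkin Y n) (tkmap f n).
Proof.
apply: cmap_eq => m v /=; rewrite /sqmap sqout0K //.
apply: submx_trans (submxMr _ sqinS) _.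
by apply: cmap_truncmx => w; exact: cmap_kerc.
Qed.

Lemma tkmap_st X Y (f : cmap X Y) n :
  ccomp (tkst Y n) (tkmap f n) = ccomp (stmap f n) (tkst X n).
Proof.
apply: cmap_eq => m v /=; rewrite !sqmapM ?mulmx1 ?mul1mx ?mul0mx ?sub0mx //.
- by apply: cmap_truncmx => w; exact: cmap_imc.
- by apply: cmap_truncmx => w; exact: cmap_kerc.
Qed.

(** Needed to truncate formal inverses: cohomology is unchanged through degree n + 1 and zero above,
    so both conditions come from those for [f]. *)
Lemma qis_tkmap X Y (f : cmap X Y) n : qis f -> qis (tkmap f n).
Proof.
move=> qf k v; have [inj surj] := qf k v.
have natE (x : 'rV_(tker X n (k + 1) v)) :
    x *m tkin X n (k + 1) v *m f (k + 1) v =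
    x *m tkmap f n (k + 1) v *m tkin Y n (k + 1) v.
  have e : tkin X n (k + 1) v *m f (k + 1) v =
      tkmap f n (k + 1) v *m tkin Y n (k + 1) v.
    exact: (congr1 (fun g => rmap (cmor g (k + 1)) v) (tkmap_in f n)).
  by rewrite -mulmxA e mulmxA.
split=> [x x0 xf|y y0].
  apply/trunc_inj/inj; first exact: trunc_cyc.
  rewrite natE (submx_trans (submxMr _ xf)) //.
  have /= <- := cmorP (tkin Y n) k v; exact: submxMl.
have [nk|kn] := ltP n k.
  exists 0; rewrite ?mul0mx // subr0; apply: trunc_inj.
  rewrite (submx_trans (trunc_inS _)) // truncmx_gt ?sub0mx //.
  by rewrite ltrD2r.
have [x x0 yx] := surj _ (trunc_cyc y0).
have [x' x'0 xE] := trunc_surj (kerc_ok X n) (truncmx_ker_cyc kn x0) x0.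
exists x' => //; apply: trunc_inj; rewrite mulmxBl.
by rewrite -natE [x' *m _]xE.
Qed.

Lemma stalkH0 X (n : int) m v : m != n + 1 -> stalkH X n m v = 0%N.
Proof.
move=> mn; rewrite /= /sqdim; apply/eqP; rewrite mxrank_eq0 -submx0.
have [mlt|mgt|/eqP] := ltgtP m (n + 1); last by rewrite (negPf mn).
  have := capmx_diff (truncmx n (kerc X) m v) (truncmx n (imc X) m v).
  by rewrite [truncmx _ (imc X) m v]truncmx_lt // capmx1 => /= ->.
by rewrite (submx_trans (diffmxSl _ _)) // truncmx_gt.
Qed.

Lemma imc_cobd X (n : int) v : imc X (n + 1) v = cobd X n v.
Proof. by apply/eq_genmx; apply: eqmx_trans (imcE X n v); exact/eqmx_sym/genmxE. Qed.

Lemma stalkHE X (n : int) v : stalkH X n (n + 1) v = hdim X n v.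
Proof. by rewrite /= !truncmx_eq imc_cobd. Qed.

Lemma cmap_inv X Y (f : cmap X Y) :
  (forall m v, row_free (f m v) /\ row_full (f m v)) ->
  exists g : cmap Y X, ccomp g f = cidmap X /\ ccomp f g = cidmap Y.
Proof.
move=> fb.
have [p [fV Vf]] : exists p : forall m v, 'M[K]_(Y m v, X m v),
    (forall m v, f m v *m p m v = 1%:M) /\ forall m v, p m v *m f m v = 1%:M.
  exists (fun m v => pinvmx (f m v)); split=> m v.
    by rewrite mulmxVp // (fb m v).1.
  by rewrite mulVpmx // (fb m v).2.
have gP m a : arr (Y m) a *m p m v2 = p m v1 *m arr (X m) a.
  rewrite -[arr (Y m) a]mul1mx -(Vf m v1) -(mulmxA _ (f m v1)) -rmapP.
  by rewrite -!mulmxA fV mulmx1.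
pose g m := @RHom K l (Y m) (X m) (p m) (gP m).
have gd m v : g m v *m cd X m v = cd Y m v *m g (m + 1) v.
  rewrite /= -[cd Y m v]mul1mx -(Vf m v) -(mulmxA _ (f m v)) cmorP.
  by rewrite -!mulmxA fV mulmx1.
by exists (@CMap K l Y X g gd); split; apply: cmap_eq => m v /=.
Qed.

Lemma cmap_bij_Diso X Y (f : cmap X Y) :
  (forall m v, row_free (f m v) /\ row_full (f m v)) -> Diso (Dmap f).
Proof.
move=> /cmap_inv[g [gf fg]]; exists (Dmap g).
by rewrite -!deq_map gf fg; split; reflexivity.
Qed.

Lemma stmap_bij X Y (f : cmap X Y) n m v : qis f ->
  row_free (stmap f n m v) /\ row_full (stmap f n m v).
Proof.
move=> qf; have [->|mn] := eqVneq m (n + 1).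
  have := qis_hmap n v qf; rewrite /hmap /=.
  by rewrite !truncmx_eq !imc_cobd.
rewrite /row_free /row_full; move: (stmap f n m v).
by rewrite !stalkH0 // => A; rewrite [A]flatmx0 mxrank0.
Qed.

(** The map induced on the stalk is a genuine chain map even when [f] contains inverses: [stalkH] is
    the cohomology itself placed in one degree, so a quasi-isomorphism induces an invertible chain
    map there. *)
Lemma dmor_roof X Y (f : dmor X Y) n :
  exists (tf : dmor (tker X n) (tker Y n)) (g : cmap (stalkH X n) (stalkH Y n)),
    deq (Dcomp f (Dmap (tkin X n))) (Dcomp (Dmap (tkin Y n)) tf) /\
    deq (Dcomp (Dmap (tkst Y n)) tf) (Dcomp (Dmap g) (Dmap (tkst X n))).
Proof.
elim: f => {X Y} [X Y f|X Y s qs|X Y W g [tg [g' [g1 g2]]] f [tf [f' [f1 f2]]]].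
- exists (Dmap (tkmap f n)), (stmap f n).
  by rewrite -!deq_map tkmap_in tkmap_st; split; reflexivity.
- have [g [gs sg]] := cmap_inv (fun m v => stmap_bij n m v qs).
  exists (Dinv (qis_tkmap n qs)), g; split.
    rewrite -[Dmap (tkin Y n)]deq_idr -(deq_invr (qis_tkmap n qs)).
    rewrite [Dcomp (Dmap (tkin Y n)) _]deq_assoc -deq_map -tkmap_in deq_map.
    by rewrite !deq_assoc deq_invl deq_idl; reflexivity.
  have stE : deq (Dmap (tkst X n))
      (Dcomp (Dmap g) (Dcomp (Dmap (tkst Y n)) (Dmap (tkmap s n)))).
    rewrite -deq_map tkmap_st deq_map deq_assoc -deq_map gs.
    by apply: deq_sym; exact: deq_idl.
  by rewrite stE -!deq_assoc deq_invr deq_idr; reflexivity.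
- exists (Dcomp tg tf), (ccomp g' f').
  rewrite -deq_assoc f1 !deq_assoc g1 g2 -!deq_assoc f2 !deq_assoc deq_map.
  by split; reflexivity.
Qed.

Lemma stalkH_cd X (n k : int) v : cd (stalkH X n) k v = 0.
Proof.
have [kn|kn] := eqVneq k (n + 1); move: (cd _ k v).
  have k1 : k + 1 != n + 1 by rewrite kn; lia.
  by rewrite (stalkH0 X v k1) => A; rewrite thinmx0.
by rewrite (stalkH0 X v kn) => A; rewrite flatmx0.
Qed.

Lemma qis_tkst X (n : int) :
  (forall k v, k < n -> hdim X k v = 0%N) -> qis (tkst X n).
Proof.
move=> X0 k v; split=> [x x0|y _].
  rewrite stalkH_cd eqmx0 submx0 /= /sqmap mulmx1 mulmxA => /eqP xB.
  apply: trunc_inj; rewrite -/(tkin X n).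
  have : x *m tkin X n (k + 1) v *m cd X (k + 1) v = 0 by exact: trunc_cyc.
  have : (x *m tkin X n (k + 1)%R v <= truncmx n (imc X) (k + 1)%R v)%MS.
    have := sqoutK (B := truncmx n (imc X) (k + 1) v) (trunc_inS x).
    by rewrite /= xB mul0mx subr0.
  move: (x *m _) => {x x0 xB} y yB y0.
  have [kn|nk|kn] := ltgtP k n.
  - by have /hdim0P := X0 k v kn; apply.
  - by move: yB; rewrite truncmx_gt ?ltrD2r // submx0 => /eqP ->; rewrite sub0mx.
  - by move: y yB y0; rewrite kn => y; rewrite truncmx_eq imcE.
have [kn|kn] := eqVneq k n; last first.
  exists 0; rewrite ?mul0mx // subr0; suff -> : y = 0 by rewrite sub0mx.
  by move: y; rewrite stalkH0 ?(inj_eq (addIr _)) // => y; rewrite thinmx0.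
pose z := y *m sqin (truncmx n (kerc X) (k + 1) v) (truncmx n (imc X) (k + 1) v).
have zZ : (z <= truncmx n (kerc X) (k + 1)%R v)%MS.
  exact: submx_trans (submxMl _ _) sqinS.
have z0 : z *m cd X (k + 1) v = 0.
  move: z zZ; rewrite kn => z; rewrite truncmx_eq; exact/sub_kermxP.
have [x x0 xz] := trunc_surj (kerc_ok X n) zZ z0.
exists x => //; rewrite /= /sqmap mulmx1 mulmxA [x *m _]xz /z -mulmxA sqinK.
by rewrite mulmx1 subrr sub0mx.
Qed.

Lemma Dcomp0r X Y W (f : dmor X Y) :
  deq (Dcomp f (Dmap (czero W X))) (Dmap (czero W Y)).
Proof.
elim: f W => {X Y} [X Y f|X Y s qs|X Y T g IHg f IHf] W.
- rewrite -deq_map; apply: deq_eq; apply: cmap_eq => n v /=.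
  by rewrite mul0mx.
- suff -> : czero W Y = ccomp s (czero W X).
    by rewrite deq_map deq_assoc deq_invl deq_idl; reflexivity.
  by apply: cmap_eq => n v /=; rewrite mul0mx.
- by rewrite -deq_assoc IHf IHg; reflexivity.
Qed.

(** The first hypothesis inverts [tkin X n], the second inverts [tkst Y n], and the third leaves
    only empty matrices in the chain map between the stalks. *)
Lemma Dhom0_of_hdim X Y (n : int) :
  (forall k v, n < k -> hdim X k v = 0%N) ->
  (forall k v, k < n -> hdim Y k v = 0%N) ->
  (forall v, hdim X n v = 0%N \/ hdim Y n v = 0%N) -> Dhom0 X Y.
Proof.
move=> Xn Yn XY f; have [tf [g [f1 f2]]] := dmor_roof f n.
have {g f2} : deq (Dcomp (Dmap (tkst Y n)) tf) (Dmap (czero _ _)).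
  rewrite f2 -deq_map; apply: deq_eq; apply: cmap_eq => m v /=.
  suff -> : g m v = 0 by rewrite mulmx0.
  have [->|mn] := eqVneq m (n + 1); move: (g _ v).
    by case: (XY v) => h0; rewrite !stalkHE h0 => A; rewrite ?[A]flatmx0 ?[A]thinmx0.
  by rewrite !stalkH0 // => A; rewrite [A]flatmx0.
have [p [pK _]] := qis_Diso (qis_tkst Yn).
have [i [_ iK]] := qis_Diso (qis_tkin Xn).
move=> tf0; have {}tf0 : deq tf (Dmap (czero _ _)).
  by rewrite -[tf]deq_idl -pK -deq_assoc tf0 Dcomp0r; reflexivity.
by rewrite -[f]deq_idr -iK deq_assoc f1 tf0 Dcomp0r Dcomp0l; reflexivity.
Qed.

End Kronecker.

(** * Mapping cones *)

Section Kronecker.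
Context {K : fieldType} {l : nat}.
Implicit Types (M N P : rep K l) (X Y W : cpx K l).


(** Rank-nullity for the projection of the row space to its first block: the image is that of [a],
    and the kernel comes from the combinations killed by [a]. *)
Lemma rank_block p q r s (a : 'M[K]_(p, q)) (f : 'M[K]_(p, r)) (b : 'M[K]_(s, r)) :
  \rank (block_mx a f 0 b) = (\rank a + \rank (kermx a *m f + b)%MS)%N.
Proof.
set P : 'M[K]_(q + r, q) := col_mx 1%:M 0.
set Q : 'M[K]_(r, q + r) := row_mx 0 1%:M.
have Qfree : row_free Q.
  by apply/row_freeP; exists (col_mx 0 1%:M); rewrite mul_row_col mul0mx mul1mx add0r.
rewrite -(mxrank_mul_ker _ P) -(mxrankMfree _ Qfree).
rewrite mul_block_col !mulmx1 !mulmx0 !addr0 (_ : \rank (col_mx a 0) = \rank a); last first.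
  by rewrite -addsmxE addsmx0.
congr (_ + _)%N; apply/eqmx_rank/andP; split.
  apply/rV_subP => u; rewrite sub_capmx => /andP[/submxP[w ->] /sub_kermxP].
  rewrite -(hsubmxK w) mul_row_block mulmx0 addr0 mul_row_col mulmx1 mulmx0 addr0.
  move=> /sub_kermxP xa.
  rewrite (_ : row_mx _ _ = (lsubmx w *m f + rsubmx w *m b) *m Q).
    by rewrite submxMr // addmx_sub_adds ?submxMr ?submxMl.
  rewrite mul_mx_row mulmx0 mulmx1; congr row_mx.
  exact/sub_kermxP.
rewrite addsmxMr addsmx_sub !sub_capmx.
have QP : Q *m P = 0 by rewrite mul_row_col mul0mx mulmx0 addr0.
apply/andP; split; apply/andP; split.
- apply/submxP; exists (row_mx (kermx a) 0).
  by rewrite mul_row_block !mul0mx mulmx_ker !addr0 mul_mx_row mulmx0 mulmx1.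
- by apply/sub_kermxP; rewrite -mulmxA QP mulmx0.
- apply/submxP; exists (row_mx 0 1%:M).
  by rewrite mul_row_block !mul0mx !mulmx0 mul1mx !add0r mul_mx_row mulmx0 mulmx1.
- by apply/sub_kermxP; rewrite -mulmxA QP mulmx0.
Qed.

Lemma kermxN p q (a : 'M[K]_(p, q)) : (kermx (- a) :=: kermx a)%MS.
Proof.
apply/eqmxP/andP; split; apply/sub_kermxP.
  by apply/eqP; rewrite -oppr_eq0 -mulmxN mulmx_ker.
by rewrite mulmxN mulmx_ker oppr0.
Qed.

Lemma hdim_shift X (n : int) v : hdim (shift X) n v = hdim X (n + 1) v.
Proof.
have := hdimE (shift X) n v; have := hdimE X (n + 1) v.
by rewrite /= !mxrank_opp; lia.
Qed.

Lemma hdim_csum X Y (n : int) v : hdim (csum X Y) n v = (hdim X n v + hdim Y n v)%N.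
Proof.
have := hdimE (csum X Y) n v; have := hdimE X n v; have := hdimE Y n v.
by rewrite /= !rank_diag_block_mx; lia.
Qed.

(* rank of the map induced by f on cohomology in degree n + 1 *)
Definition hrank X Y (f : cmap X Y) (n : int) v : nat :=
  \rank (cocyc X n v *m f (n + 1)%R v + cd Y n v)%MS - \rank (cd Y n v).

Lemma rank_cone X Y (f : cmap X Y) (n : int) v :
  \rank (cd (cone f) n v) =
  (\rank (cd X (n + 1) v) + \rank (cd Y n v) + hrank f n v)%N.
Proof.
rewrite /= rank_block mxrank_opp /hrank -addnA; congr (_ + _)%N.
rewrite subnKC ?mxrankS ?addsmxSr //; apply/eqmx_rank/eqmxP/adds_eqmx => //.
exact/eqmxMr/kermxN.
Qed.

(** The long exact sequence in dimensions: cohomology of the cone is the cokernel of [f] plus its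
    kernel one degree up. *)
Lemma hdim_cone X Y (f : cmap X Y) (n : int) v :
  (hdim (cone f) n v + hrank f n v + hrank f (n + 1) v =
   hdim X (n + 1) v + hdim Y n v)%N.
Proof.
have := hdimE (cone f) n v; have := hdimE X (n + 1) v; have := hdimE Y n v.
by rewrite !rank_cone /=; lia.
Qed.

Lemma hrank_eqmx X Y (f : cmap X Y) (n : int) v :
  (cocyc X n v *m f (n + 1)%R v + cd Y n v :=:
   (cocyc X n v :\: cobd X n v) *m f (n + 1)%R v + cd Y n v)%MS.
Proof.
apply/eqmxP/andP; split; rewrite addsmx_sub addsmxSr andbT; last first.
  by rewrite (submx_trans _ (addsmxSl _ _)) // submxMr // diffmxSl.
rewrite -(eqmxMr _ (addsmx_diff_cap_eq (cocyc X n v) (cobd X n v))) addsmxMr.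
rewrite addsmxS // (submx_trans (submxMr _ (capmxSr _ _))) //.
by rewrite (submx_trans (cmap_cobd f n v)) // genmxE.
Qed.

Lemma hrank_lel X Y (f : cmap X Y) (n : int) v : (hrank f n v <= hdim X n v)%N.
Proof.
rewrite /hrank leq_subLR (hrank_eqmx f n v) addnC.
by rewrite (leq_trans (mxrank_adds_leqif _ _)) // leq_add2r mxrankM_maxl.
Qed.

Lemma hrank_ler X Y (f : cmap X Y) (n : int) v : (hrank f n v <= hdim Y n v)%N.
Proof.
have := sqdimE (cobdS Y n v); rewrite -/(hdim Y n v) mxrank_gen => hY.
rewrite /hrank leq_subLR addnC hY mxrankS // addsmx_sub cmap_cocyc /=.
by rewrite -(genmxE (cd Y n v)) cobdS.
Qed.

Lemma hrank_inj X Y (f : cmap X Y) (n : int) v :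
  (forall x : 'rV_(X (n + 1) v), x *m cd X (n + 1) v = 0 ->
     (x *m f (n + 1)%R v <= cd Y n v)%MS -> (x <= cd X n v)%MS) ->
  hrank f n v = hdim X n v.
Proof.
move=> inj; rewrite /hrank (hrank_eqmx f n v).
set C := (cocyc X n v :\: cobd X n v)%MS.
have C0 (x : 'rV_(X (n + 1) v)) :
    (x <= C)%MS -> (x *m f (n + 1)%R v <= cd Y n v)%MS -> x = 0.
  move=> xC xf; apply/eqP; rewrite -submx0 -(capmx_diff (cocyc X n v) (cobd X n v)).
  rewrite sub_capmx xC genmxE inj //.
  by apply/sub_kermxP; rewrite (submx_trans xC) // diffmxSl.
rewrite mxrank_disjoint_sum; last first.
  apply/eqP; rewrite -submx0; apply/rV_subP => u; rewrite sub_capmx.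
  move=> /andP[/submxP[w ->] wf]; rewrite mulmxA in wf *.
  by rewrite (C0 (w *m C)) ?submxMl // mul0mx sub0mx.
rewrite addnK -[RHS](mxrank_mul_ker C (f (n + 1) v)).
rewrite (_ : (C :&: _)%MS = 0) ?mxrank0 ?addn0 //.
apply/eqP; rewrite -submx0; apply/rV_subP => u; rewrite sub_capmx.
by move=> /andP[uC /sub_kermxP uf]; rewrite (C0 u uC) ?sub0mx // uf sub0mx.
Qed.

Lemma hdim_cone_inj X Y (f : cmap X Y) :
  (forall (n : int) v, hrank f n v = hdim X n v) ->
  forall (n : int) v, hdim Y n v = (hdim X n v + hdim (cone f) n v)%N.
Proof. by move=> fX n v; have := hdim_cone f n v; rewrite !fX; lia. Qed.

(** The hypothesis kills the connecting maps. In the count of [hdim_cone], together with the two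
    upper bounds on [hrank], this makes [f] injective on cohomology. *)
Lemma hdim_triangle (A B C : cpx K l) (u : dmor A B) (v : dmor B C)
    (w : dmor C (shift A)) : exact_triangle u v w ->
  (forall (n : int) i, hdim C n i = 0%N \/ hdim A (n + 1) i = 0%N) ->
  forall (n : int) i, hdim B n i = (hdim A n i + hdim C n i)%N.
Proof.
move=> [X [Y [f [a [b [c [[ai bi ci] _]]]]]]] CA n i.
have AX m j : hdim X m j = hdim A m j by apply: isomorphic_hdim; exists a.
have BY m j : hdim Y m j = hdim B m j by apply: isomorphic_hdim; exists b.
have CZ m j : hdim (cone f) m j = hdim C m j by apply: isomorphic_hdim; exists c.
rewrite -AX -BY -CZ; apply: hdim_cone_inj => {n i} n i.
suff H (m : int) : hrank f (m + 1) i = hdim X (m + 1) i.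
  by rewrite -[n](subrK 1); exact: H.
have := hdim_cone f m i; have := hrank_lel f (m + 1) i; have := hrank_ler f m i.
by case: (CA m i); rewrite -?CZ -?AX; lia.
Qed.

Lemma cone_triangle X Y (f : cmap X Y) :
  exists (u : dmor X Y) (v : dmor Y (cone f)) (w : dmor (cone f) (shift X)),
    exact_triangle u v w.
Proof.
exists (Dmap f), (Dmap (cone_in f)), (Dmap (cone_out f)).
exists X, Y, f, (Did X), (Did Y), (Did (cone f)).
split; first by split; exact: Diso_id.
split; rewrite !deq_idr ?deq_idl; try reflexivity.
suff -> : Dshift (Did X) = Did (shift X) by rewrite deq_idl; reflexivity.
by congr Dmap; apply: cmap_eq.
Qed.

Lemma sqin0E n (Z : 'M[K]_n) : (sqin Z 0 :=: Z)%MS.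
Proof.
apply/eqmxP/andP; split; first exact: sqinS.
by rewrite -[X in (X <= _)%MS](sqout0K (submx_refl Z)) submxMl.
Qed.

Lemma rank_sqmap0 n1 n2 (Z : 'M[K]_n1) (Z' : 'M[K]_n2) (f : 'M[K]_(n1, n2)) :
  (Z *m f <= Z')%MS -> \rank (sqmap Z 0 Z' 0 f) = \rank (Z *m f).
Proof.
move=> fZ; rewrite -(eqmxMr f (sqin0E Z)) /sqmap.
apply/eqP; rewrite eqn_leq mxrankM_maxl /=.
have fZ' : (sqin Z 0 *m f <= Z')%MS by rewrite (eqmxMr f (sqin0E Z)).
by rewrite -{1}(sqout0K fZ') mxrankM_maxl.
Qed.

Lemma hdim_trunc X (n : int) A (ok : @trunc_ok K l X n A) (k : int) v :
  hdim (trunc ok) k v =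
  if k < n then hdim X k v
  else if k == n then (\rank (A (n + 1)%R v) - \rank (cd X n v))%N else 0%N.
Proof.
have := hdimE (trunc ok) k v.
rewrite /= !rank_sqmap0 ?truncmx_cd //.
have -> : sqdim (truncmx n A (k + 1) v) 0 = \rank (truncmx n A (k + 1)%R v).
  by have := sqdimE (sub0mx _ (truncmx n A (k + 1) v)); rewrite mxrank0 addn0.
have [kn|nk|->] := ltgtP k n.
- have kn1 : k < n + 1 by lia.
  move: (hdimE X k v); rewrite !truncmx_lt ?ltrD2r // !mul1mx mxrank1; lia.
- by rewrite [truncmx _ _ (k + 1) _]truncmx_gt ?ltrD2r // mxrank0; lia.
- rewrite truncmx_eq trok_ker // mxrank0 truncmx_lt; last by lia.
  by rewrite mul1mx; lia.
Qed.

(* Replacing cocycles by coboundaries at the single place (n, w) gives a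
   subcomplex, since (n, w) comes last in the order of decreasing phases. *)
Lemma remove_top X (n : int) w :
  (forall (k : int) v, n < k -> hdim X k v = 0%N) ->
  (w = v2 -> hdim X n v1 = 0%N) ->
  exists Y (u : cmap Y X), forall (k : int) v,
    hdim Y k v = (if (k == n) && (v == w) then 0%N else hdim X k v) /\
    hdim (cone u) k v = (if (k == n) && (v == w) then hdim X k v else 0%N).
Proof.
move=> Xn Xw; pose A m v := if v == w then imc X m v else kerc X m v.
have imker v : (imc X (n + 1)%R v <= kerc X (n + 1)%R v)%MS.
  by rewrite imc_cobd cobdS.
have Aker v : (A (n + 1)%R v <= kerc X (n + 1)%R v)%MS by rewrite /A; case: ifP.
have imA v : (imc X (n + 1)%R v <= A (n + 1)%R v)%MS by rewrite /A; case: ifP.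
have ok : trunc_ok n A.
  split=> [a|v|v]; last by apply/sub_kermxP; exact: Aker.
    (* Stability under arrows matters only at their end v2. If A is cut down there, cocycles at v1
       are coboundaries by hypothesis, and arrows preserve coboundaries. *)
    have [/Xw h0|w1] := eqVneq w v2.
      apply: submx_trans (imA v2); apply: submx_trans (trok_arr (imc_ok X n) a).
      apply/submxMr/(submx_trans (Aker v1)); rewrite imcE.
      by apply/rV_subP => x /sub_kermxP; have /hdim0P := h0; apply.
    have -> : A (n + 1) v2 = kerc X (n + 1) v2 by rewrite /A eq_sym (negPf w1).
    by apply: submx_trans (trok_arr (kerc_ok X n) a); apply/submxMr/Aker.
  by rewrite -(imcE X n v).
exists (trunc ok), (trunc_in ok) => k v.
have XT := hdim_cone_inj (fun n v => hrank_inj (fun x _ => @trunc_inj _ _ _ _ _ ok n v x)).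
have hT : hdim (trunc ok) k v = if (k == n) && (v == w) then 0%N else hdim X k v.
  rewrite hdim_trunc; have [kn|nk|->] //= := ltgtP k n; first by rewrite Xn.
  rewrite /A; case: (eqVneq v w) => _; first by rewrite imcE subnn.
  rewrite mxrank_ker; have := hdimE X n v; lia.
by have := XT k v; rewrite hT; case: ifP; lia.
Qed.

End Kronecker.

(** * Shifts, stalk complexes and Euler characteristics *)

Section Kronecker.
Context {K : fieldType} {l : nat}.
Implicit Types (M N P : rep K l) (X Y W : cpx K l).


Lemma ccast_comp X m n p (e : m = n) (e' : n = p) (e'' : m = p) v :
  ccast X e v *m ccast X e' v = ccast X e'' v.
Proof. by case: p / e' e''; case: n / e => e''; rewrite !ccast_id mulmx1. Qed.

Lemma unshift_eq (n : int) : n - 1 + 1 = n + 1 - 1.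
Proof. by rewrite subrK addrK. Qed.

Program Definition unshift X : cpx K l :=
  @Cpx K l (fun n => X (n - 1))
    (fun n => ropp (rcomp (ccast X (unshift_eq n)) (cd X (n - 1)))) _ _.
Next Obligation.
move=> X n v /=; rewrite mulNmx mulmxN opprK.
rewrite mulmxA -[cd X (n - 1) v *m _ *m _]mulmxA.
have e : n - 1 + 1 + 1 = n + 1 - 1 + 1 by rewrite unshift_eq.
by rewrite -(ccast_cd X (unshift_eq n) e) mulmxA cdd !mul0mx.
Qed.
Next Obligation.
move=> X; have [N HN] := cbd X; exists N.+1 => n Nn v; apply: HN; lia.
Qed.

Lemma shift_unshift X : isomorphic X (shift (unshift X)).
Proof.
have e (n : int) : n = n + 1 - 1 by rewrite addrK.
have fP (n : int) v : ccast X (e n) v *m cd (shift (unshift X)) n v =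
    cd X n v *m ccast X (e (n + 1)) v.
  rewrite /= opprK mulmxA; have e' : n + 1 = n + 1 - 1 + 1 by rewrite subrK.
  rewrite -(ccast_cd X (e n) e') -mulmxA; congr (_ *m _).
  exact: ccast_comp.
exists (Dmap (@CMap K l X (shift (unshift X)) (fun n => ccast X (e n)) fP)).
apply: cmap_bij_Diso => m v /=; case: _ / (e m) => /=.
by rewrite row_free_unit row_full_unit unitmx1.
Qed.

Lemma stalk_dim0 M (n : int) v : n != 0 -> stalk M n v = 0%N.
Proof. by case: n => [[|n]|n]. Qed.

(** Index -1 is degree 0, by the convention of [hdim]. *)
Lemma hdim_stalk0 M (n : int) v : n != -1 -> hdim (stalk M) n v = 0%N.
Proof.
move=> n1; apply/eqP; rewrite -leqn0 (leq_trans (hdim_le _ _ _)) // stalk_dim0 //.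
by rewrite -subr_eq0 opprK in n1.
Qed.

Lemma hdim_stalk M v : hdim (stalk M) (-1) v = M v.
Proof. by have := hdimE (stalk M) (-1) v; rewrite /= !mxrank0 !addn0. Qed.

Lemma stalk_of_hdim X : (forall (n : int) v, n != -1 -> hdim X n v = 0%N) ->
  exists2 M, isomorphic X (stalk M) & forall v, M v = hdim X (-1) v.
Proof.
move=> X0; pose S := stalkH X (-1); exists (S 0); last first.
  by move=> v; rewrite -stalkHE.
apply: (isomorphic_trans (Y := tker X (-1))).
  apply/isomorphic_sym/qis_isomorphic/qis_tkin => k v k1.
  by rewrite X0 // gt_eqF.
apply: (isomorphic_trans (Y := S)).
  apply/qis_isomorphic/qis_tkst => k v k1.
  by rewrite X0 // lt_eqF.
pose f (m : int) : rhom (S m) (stalk (S 0) m) :=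
  match m with Posz 0 => rid _ | _ => rzero _ _ end.
have fP (m : int) v : f m v *m cd (stalk (S 0)) m v = cd S m v *m f (m + 1) v.
  by rewrite stalkH_cd mul0mx mulmx0.
exists (Dmap (@CMap K l S (stalk (S 0)) f fP)); apply: cmap_bij_Diso => m v.
have [->|m0] := eqVneq m 0.
  by rewrite row_free_unit row_full_unit unitmx1.
suff : forall A : 'M[K]_(S m v, stalk (S 0) m v), row_free A /\ row_full A by apply.
rewrite stalkH0 ?stalk_dim0 // => A.
by rewrite /row_free /row_full [A]flatmx0 mxrank0.
Qed.

Definition zrange (N : nat) : seq int := [seq i%:Z - N%:Z | i <- iota 0 (2 * N + 1)%N].

Lemma mem_zrange (N : nat) (n : int) : (n \in zrange N) = (`|n| <= N)%N.
Proof.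
apply/mapP/idP => [|nN]; first by case=> i; rewrite mem_iota => iN ->; lia.
exists `|(n + N%:Z)%R|%N; first by rewrite mem_iota; lia.
by lia.
Qed.

Lemma uniq_zrange (N : nat) : uniq (zrange N).
Proof. by rewrite map_inj_uniq ?iota_uniq // => i j; lia. Qed.

Lemma sum_intE (V : nmodType) (N : nat) (F : int -> V) :
  (forall n, (N < `|n|)%N -> F n = 0) ->
  \sum_(n \in [set: int]) F n = \sum_(n <- zrange N) F n.
Proof.
move=> F0; rewrite (fsbigE (zrange N)) ?uniq_zrange //.
  by apply: eq_bigl => n; rewrite in_setT.
by move=> n _; rewrite mem_zrange -ltnNge; exact: F0.
Qed.

Lemma hdim_bound X : exists N : nat, forall (n : int),
  (N < `|n|)%N -> forall v, X n v = 0%N /\ hdim X n v = 0%N.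
Proof.
have [N HN] := cbd X; exists N.+1 => n Nn v; split; first by apply: HN; lia.
by apply/eqP; rewrite -leqn0 (leq_trans (hdim_le _ _ _)) // HN; lia.
Qed.

Lemma sgz_succ (n : int) : (-1) ^+ `|(n + 1)%R|%N = - (-1) ^+ `|n|%N :> int.
Proof.
case: n => n.
  by rewrite -[`|_|%N]/(absz (n + 1)%N%:Z) absz_nat addn1 exprS mulN1r.
rewrite NegzE (_ : `|(- n.+1%:Z + 1)%R|%N = n) ?abszN ?absz_nat; last by lia.
by rewrite exprS mulN1r opprK.
Qed.

Lemma sum_int_shift (V : nmodType) (F : int -> V) :
  \sum_(n \in [set: int]) F (n + 1) = \sum_(n \in [set: int]) F n.
Proof.
apply/esym/reindex_fsbigT.
by exists (fun n => n - 1) => n /=; rewrite ?addrK ?subrK.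
Qed.

(** By [hdimE] the terms of the complex differ from its cohomology by consecutive signed ranks,
    which telescope. *)
Lemma K0classE X v :
  K0class X 0 v = \sum_(n \in [set: int]) (-1) ^+ `|(n + 1)%R|%N * (hdim X n v)%:Z.
Proof.
have [N HN] := hdim_bound X.
pose s (n : int) : int := (-1) ^+ `|n|%N.
pose G n := s n * (\rank (cd X n v))%:Z.
have XE (n : int) : s (n + 1) * (X (n + 1) v)%:Z =
    s (n + 1) * (hdim X n v)%:Z + (G (n + 1) - G n).
  rewrite -(hdimE X n v) !PoszD /G /s !mulrDr sgz_succ !mulNr; lia.
have X0 (n : int) : (N < `|n|)%N -> X n v = 0%N.
  by move=> /HN /(_ v) [].
have G0 (n : int) : (N < `|n|)%N -> G n = 0.
  move=> Nn; rewrite /G (_ : \rank _ = 0%N) ?mulr0 //.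
  by apply/eqP; rewrite -leqn0 -(X0 n Nn) rank_leq_row.
rewrite mxE -sum_int_shift.
transitivity (\sum_(n \in [set: int])
    (s (n + 1) * (hdim X n v)%:Z + (G (n + 1) - G n))).
  by apply: eq_fsbigr => n _; exact: XE.
(* One more than N, since [G (n + 1)] reaches one degree past the window. *)
rewrite (sum_intE (N := N.+1)); last first.
  move=> n Nn; rewrite (HN n _ v).2 ?mulr0 ?add0r ?G0 ?subrr //; lia.
rewrite big_split sumrB /= -!(sum_intE (N := N.+1)).
- by rewrite (sum_int_shift G) subrr addr0.
- by move=> n Nn; apply: G0; lia.
- by move=> n Nn; apply: G0; lia.
- by move=> n Nn; rewrite (HN n _ v).2 ?mulr0 //; lia.
Qed.

(** Unsigned counterpart of [K0class]: the multiplicity of S_v over all degrees, from which masses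
    are computed. *)
Definition hsum X v : nat := \sum_(n \in [set: int]) hdim X n v.

Lemma hsumD X Y W : (forall (n : int) v, hdim Y n v = (hdim X n v + hdim W n v)%N) ->
  forall v, hsum Y v = (hsum X v + hsum W v)%N.
Proof.
move=> YE v; have [N HX] := hdim_bound X; have [N' HW] := hdim_bound W.
rewrite /hsum (_ : \sum_(n \in [set: int]) hdim Y n v =
  \sum_(n \in [set: int]) (hdim X n v + hdim W n v)%N); last exact: eq_fsbigr.
rewrite !(@sum_intE _ (maxn N N')) ?big_split //.
- by move=> n; rewrite gtn_max => /andP[_ /HW /(_ v) []].
- by move=> n; rewrite gtn_max => /andP[/HX /(_ v) []].
- move=> n; rewrite gtn_max => /andP[/HX /(_ v) [_ ->] /HW /(_ v) [_ ->]] //.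
Qed.

Lemma sum_int_single (V : nmodType) (F : int -> V) m :
  (forall n, n != m -> F n = 0) -> \sum_(n \in [set: int]) F n = F m.
Proof.
move=> F0; rewrite (fsbigE [:: m]) //.
  by rewrite big_cons big_nil in_setT; exact: addr0.
by move=> n _; rewrite inE; exact: F0.
Qed.

Lemma hsum0 X v : (forall n : int, hdim X n v = 0%N) -> hsum X v = 0%N.
Proof. by move=> X0; rewrite /hsum (@sum_int_single _ _ 0). Qed.

Lemma K0class_stalk M : K0class (stalk M) = \row_v (M v)%:Z.
Proof.
apply/rowP => v; rewrite K0classE mxE (@sum_int_single _ _ (-1)).
  by rewrite hdim_stalk mul1r.
by move=> n n1; rewrite hdim_stalk0 // mulr0.
Qed.

End Kronecker.

(** * Harder-Narasimhan filtrations *)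

Section Stability.
Local Open Scope classical_set_scope.
Context {R : realType} {l : nat}.
Local Notation C := R[i].
Local Notation obj := (cpx C l).
Implicit Types (E X Y : obj).

Lemma vertexP (v : 'I_2) : v = v1 \/ v = v2.
Proof. by case: v => [[|[|//]] lt]; [left|right]; apply: val_inj. Qed.

Definition chamber (ph : 'I_2 -> R) : Prop := ph v1 < ph v2 < ph v1 + 1.

(* phase of a complex whose only cohomology is S_v^h in degree n + 1 *)
Definition pphase (ph : 'I_2 -> R) (n : int) v : R := ph v - (n + 1)%:~R.

(* The classes (n, v), listed by decreasing phase. *)
Definition level (n : int) (v : 'I_2) : int := n + n + (v == v1)%:Z.

Lemma level1 n : level n v1 = n + n + 1. Proof. by []. Qed.
Lemma level2 n : level n v2 = n + n. Proof. exact: addr0. Qed.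

Lemma level_inj (n n' : int) v v' : level n v = level n' v' -> n = n' /\ v = v'.
Proof.
by case: (vertexP v) (vertexP v') => [] -> [] ->; rewrite ?level1 ?level2 => ?;
  split => //; lia.
Qed.

Lemma pphase_level ph (n n' : int) v v' : chamber ph ->
  level n v < level n' v' -> pphase ph n' v' < pphase ph n v.
Proof.
move=> /andP[p12 p21]; rewrite /pphase => lt.
have [nn|nn] : n < n' \/ (n = n' /\ v = v2 /\ v' = v1).
  have [|n'n] := ltP n n'; [by left|right].
  by move: lt; case: (vertexP v) (vertexP v') => [] -> [] ->;
    rewrite ?level1 ?level2 => ?; split => //; lia.
- have : (n + 1 + 1)%:~R <= (n' + 1)%:~R :> R by rewrite ler_int lerD2r; lia.
  rewrite [(n + 1 + 1)%:~R]intrD.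
  by case: (vertexP v) (vertexP v') => [] -> [] ->; lra.
- by case: nn => -> [-> ->]; lra.
Qed.

(** Turns comparisons of phases into comparisons of integers, the same for every [ph] in the
    chamber. *)
Lemma pphase_lt ph (n n' : int) v v' : chamber ph ->
  (pphase ph n' v' < pphase ph n v) = (level n v < level n' v').
Proof.
move=> ch; have [lt|lt|/level_inj[-> ->]] := ltgtP (level n v); last by rewrite ltxx.
  exact: pphase_level.
by apply/negbTE; rewrite -leNgt ltW // pphase_level.
Qed.

Lemma pphase_inj ph (n n' : int) v v' : chamber ph ->
  pphase ph n v = pphase ph n' v' -> n = n' /\ v = v'.
Proof.
move=> ch eq; apply: level_inj; apply/eqP; rewrite eq_le !leNgt.
by rewrite -!(pphase_lt _ _ _ _ ch) eq ltxx.
Qed.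

(** In the chamber phases determine (n, v), so a nonzero object here has cohomology at one vertex in
    one degree. *)
Definition kslice (ph : 'I_2 -> R) (phi : R) : set obj :=
  [set E | forall (n : int) v, (0 < hdim E n v)%N -> phi = pphase ph n v].

Definition pure E (n : int) v : Prop :=
  (0 < hdim E n v)%N /\
  forall (n' : int) v', (0 < hdim E n' v')%N -> n' = n /\ v' = v.

Lemma not_zeroP E : ~ is_zero E -> exists (n : int) v, (0 < hdim E n v)%N.
Proof.
move=> E0; apply: contrapT => noh; apply: E0; apply/is_zeroP => n v.
by apply/eqP; rewrite -leqn0 leqNgt; apply/negP => h; apply: noh; exists n, v.
Qed.

Lemma not_zero E (n : int) v : (0 < hdim E n v)%N -> ~ is_zero E.
Proof. by move=> h /is_zeroP h0; rewrite h0 in h. Qed.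

Lemma kslice_pure ph phi E : chamber ph -> kslice ph phi E -> ~ is_zero E ->
  exists (n : int) v, phi = pphase ph n v /\ pure E n v.
Proof.
move=> ch PE /not_zeroP[n [v h]]; exists n, v; split; first exact: PE.
by split => // n' v' h'; apply: (pphase_inj ch); rewrite -!PE.
Qed.

Lemma pure_kslice ph (n : int) v E : pure E n v -> kslice ph (pphase ph n v) E.
Proof. by move=> [_ pE] n' v' /pE[-> ->]. Qed.

Section HNAnalysis.
Context (ph : 'I_2 -> R) (ch : chamber ph) (E : obj) (h : HN (kslice ph) E).

Lemma hn_fac_pure i : (i < hn_len h)%N ->
  exists (n : int) v, hn_phase h i = pphase ph n v /\ pure (hn_fac h i) n v.
Proof.
by move=> il; apply: kslice_pure => //; [exact: hn_facP|exact: hn_fac_neq0].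
Qed.

(** Invariant of the induction along the filtration: it puts the cohomology of a step at phases of
    earlier factors, which kills the next connecting map, and additivity then propagates it. *)
Let support i := forall (n : int) v, (0 < hdim (hn_obj h i) n v)%N ->
  exists2 j, (j < i)%N & (0 < hdim (hn_fac h j) n v)%N.

(* All connecting maps of the triangles of a Harder-Narasimhan filtration vanish
   in cohomology, since the phases decrease. *)
Let hdim_step i : (i < hn_len h)%N -> support i -> forall (n : int) v,
  hdim (hn_obj h i.+1) n v = (hdim (hn_obj h i) n v + hdim (hn_fac h i) n v)%N.
Proof.
move=> il IH; have [u [w [t tri]]] := hn_triangle il.
apply: (hdim_triangle tri) => n v.
have [|fp] := posnP (hdim (hn_fac h i) n v); first by left.
have [|op] := posnP (hdim (hn_obj h i) (n + 1) v); first by right.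
have [j ji jp] := IH _ _ op; have := hn_decr ji il.
have -> := (hn_facP il) _ _ fp; have -> := (hn_facP (ltn_trans ji il)) _ _ jp.
by rewrite pphase_lt //; case: (vertexP v) => ->; rewrite ?level1 ?level2; lia.
Qed.

Let supportP i : (i <= hn_len h)%N -> support i.
Proof.
elim: i => [|i IH] il n v.
  by have /is_zeroP -> := hn_start h.
rewrite hdim_step //; last exact: IH (ltnW il).
have [->|fp _] := posnP (hdim (hn_fac h i) n v); last by exists i.
by rewrite addn0 => /(IH (ltnW il))[j ji jp]; exists j => //; exact: ltnW.
Qed.

Lemma hn_hdim i : (i < hn_len h)%N -> forall (n : int) v,
  hdim (hn_obj h i.+1) n v = (hdim (hn_obj h i) n v + hdim (hn_fac h i) n v)%N.
Proof. by move=> il; apply: hdim_step => //; exact/supportP/ltnW. Qed.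

Lemma hn_hdim_le i j : (i <= j <= hn_len h)%N -> forall (n : int) v,
  (hdim (hn_obj h i) n v <= hdim (hn_obj h j) n v)%N.
Proof.
elim: j => [|j IH] /andP[ij jl] n v; first by move: ij; rewrite leqn0 => /eqP ->.
move: ij; rewrite leq_eqVlt => /orP[/eqP -> //|ij].
by rewrite hn_hdim // (leq_trans (IH _ n v)) ?leq_addr // -ltnS ij ltnW.
Qed.

(** With [hdim_hn_phase], the phases of any filtration are exactly those of the cohomology pieces of
    E, so different filtrations never have to be compared directly. *)
Lemma hn_phase_hdim i : (i < hn_len h)%N ->
  exists (n : int) v, hn_phase h i = pphase ph n v /\ (0 < hdim E n v)%N.
Proof.
move=> il; have [n [v [-> [fp _]]]] := hn_fac_pure il; exists n, v; split => //.
rewrite -(hn_end h) (leq_trans _ (@hn_hdim_le i.+1 _ _ n v)) ?il ?leqnn //.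
by rewrite hn_hdim // ltn_addl.
Qed.

Lemma hdim_hn_phase (n : int) v : (0 < hdim E n v)%N ->
  exists2 i, (i < hn_len h)%N & hn_phase h i = pphase ph n v.
Proof.
rewrite -{1}(hn_end h) => /(supportP (leqnn _))[i il ip].
by exists i => //; exact: (hn_facP il _ _ ip).
Qed.

Lemma hn_hsum i : (i <= hn_len h)%N -> forall v,
  hsum (hn_obj h i) v = (\sum_(j < i) hsum (hn_fac h j) v)%N.
Proof.
elim: i => [|i IH] il v.
  by rewrite big_ord0 hsum0 // => n; have /is_zeroP -> := hn_start h.
rewrite big_ord_recr /= -(IH (ltnW il) v); apply: hsumD; exact: hn_hdim.
Qed.

End HNAnalysis.

Lemma HN_cone (P : R -> set obj) X Y (u : cmap Y X) (h : HN P Y) psi :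
  ~ is_zero (cone u) -> P psi (cone u) ->
  (forall i, (i < hn_len h)%N -> psi < hn_phase h i) -> inhabited (HN P X).
Proof.
(* The equation [hn_end] must be eliminated before [u] becomes a map out of the last step [F n]. *)
case: h => /= n F A p F0 FE tri A0 PA dec u0 Pu lt; case: Y / FE u u0 Pu => u u0 Pu.
split; apply: (@MkHN R l P X n.+1 (fun i => if (i <= n)%N then F i else X)
  (fun i => if (i < n)%N then A i else cone u)
  (fun i => if (i < n)%N then p i else psi)) => //.
- by rewrite ltnn.
- move=> i; rewrite ltnS leq_eqVlt => /orP[/eqP ->|il] /=; last first.
    by rewrite il orbT; exact: tri.
  by rewrite eqxx ltnn; exact: cone_triangle.
- by move=> i _ /=; case: ltnP => // il; exact: A0.
- by move=> i _ /=; case: ltnP => // il; exact: PA.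
- move=> i j ij /=; rewrite ltnS => jn; have il := leq_trans ij jn.
  by rewrite il; case: ltnP => jl; [exact: dec|exact: lt].
Qed.

(** Induction on the number of admissible levels: the piece of highest level has the lowest phase,
    and [remove_top] splits it off as the last factor. *)
Lemma HN_kslice ph E : chamber ph -> inhabited (HN (kslice ph) E).
Proof.
move=> ch; have [N HN_] := hdim_bound E.
have lo (n : int) v : (0 < hdim E n v)%N -> - (2 * N%:Z) <= level n v < 2 * N%:Z + 2.
  move=> hp; have : (`|n| <= N)%N.
    by rewrite leqNgt; apply/negP => /HN_ /(_ v)[_ h0]; rewrite h0 in hp.
  by case: (vertexP v) => ->; rewrite ?level1 ?level2; lia.
suff H (c : nat) X : (forall (n : int) v, (0 < hdim X n v)%N ->
    - (2 * N%:Z) <= level n v < c%:Z - 2 * N%:Z) -> inhabited (HN (kslice ph) X).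
  (* For indices between -N and N the levels run from -2N to 2N + 1. *)
  by apply: (H (4 * N + 2)%N) => n v /lo; lia.
elim: c X => [|c IH] X Xc.
  split; apply: (@MkHN R l _ X 0 (fun _ => X) (fun _ => X) (fun _ => 0)) => //.
  apply/is_zeroP => n v; apply/eqP; rewrite -leqn0 leqNgt; apply/negP => /Xc.
  by lia.
have [[n [v [hp lev]]]|no] := pselect (exists (n : int) v,
    (0 < hdim X n v)%N /\ level n v = c%:Z - 2 * N%:Z); last first.
  apply: IH => n v hp; have := Xc n v hp.
  have : level n v <> c%:Z - 2 * N%:Z by move=> e; apply: no; exists n, v.
  by lia.
have [||Y [u uE]] := @remove_top _ _ X n v.
- move=> k w nk; apply/eqP; rewrite -leqn0 leqNgt; apply/negP => /Xc.
  by move: lev; case: (vertexP v) (vertexP w) => [] -> [] ->; rewrite ?level1 ?level2; lia.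
- move=> v2E; apply/eqP; rewrite -leqn0 leqNgt; apply/negP => /Xc.
  by move: lev; rewrite v2E level1 level2; lia.
have Yc (k : int) w : (0 < hdim Y k w)%N ->
    - (2 * N%:Z) <= level k w < c%:Z - 2 * N%:Z.
  rewrite (uE k w).1; case: ifP => // kw hk; have := Xc k w hk.
  have : level k w <> level n v.
    by move=> /level_inj[kn wv]; rewrite kn wv !eqxx in kw.
  by rewrite lev; lia.
have [h] := IH Y Yc.
have pu : pure (cone u) n v.
  split; first by rewrite (uE n v).2 !eqxx.
  by move=> k w; rewrite (uE k w).2; case: ifP => // /andP[/eqP -> /eqP ->].
apply: (HN_cone (h := h) (psi := pphase ph n v)).
- exact: not_zero pu.1.
- exact: pure_kslice.
- move=> i il; have [k [w [-> kw]]] := hn_phase_hdim ch il.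
  by rewrite pphase_lt // lev; case/andP: (Yc k w kw).
Qed.

End Stability.

(** * The stability conditions *)

Section Stability.
Local Open Scope classical_set_scope.
Context {R : realType} {l : nat}.
Local Notation C := R[i].
Local Notation obj := (cpx C l).
Implicit Types (E X Y : obj).

Lemma kslice_iso ph phi X Y : isomorphic X Y -> kslice ph phi X -> kslice ph phi Y.
Proof. by move=> XY PX n v; rewrite -(isomorphic_hdim n v XY); exact: PX. Qed.

Lemma kslice0 ph phi E : is_zero E -> kslice ph phi E.
Proof. by move=> /is_zeroP E0 n v; rewrite E0. Qed.

Lemma kslice_sum ph phi X Y :
  kslice ph phi X -> kslice ph phi Y -> kslice ph phi (csum X Y).
Proof.
move=> PX PY n v; rewrite hdim_csum addn_gt0 => /orP[]; [exact: PX|exact: PY].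
Qed.

Lemma kslice_shift ph phi E :
  kslice ph (phi + 1) E <-> exists2 F, kslice ph phi F & isomorphic E (shift F).
Proof.
have pS (n : int) v : pphase ph n v = pphase ph (n + 1) v + 1.
  by rewrite /pphase intrD; lra.
split=> [PE|[F PF /isomorphic_sym]]; last first.
  by move/kslice_iso; apply => n v; rewrite hdim_shift => /PF ->; rewrite [RHS]pS.
exists (unshift E); last exact: shift_unshift.
suff H (n : int) v : (0 < hdim (unshift E) (n + 1) v)%N -> phi = pphase ph (n + 1) v.
  by move=> n v; rewrite -[n](subrK 1); exact: H.
rewrite -hdim_shift -(isomorphic_hdim _ _ (shift_unshift E)) => /PE; rewrite pS.
exact: addIr.
Qed.

Lemma kslice_hom0 ph phi1 phi2 X Y : chamber ph -> phi2 < phi1 ->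
  kslice ph phi1 X -> kslice ph phi2 Y -> Dhom0 X Y.
Proof.
move=> ch lt PX PY.
have XY (n k : int) v w : (0 < hdim X n v)%N -> (0 < hdim Y k w)%N ->
    level n v < level k w.
  by move=> /PX p1 /PY p2; rewrite -(pphase_lt _ _ _ _ ch) -p1 -p2.
have [[k [w hk]]|noY] := pselect (exists (k : int) w, (0 < hdim Y k w)%N).
  (* All cohomology of Y sits at (k, w) and that of X at smaller levels: at index at most k, and at
     k only on the other vertex. *)
  apply: (@Dhom0_of_hdim _ _ _ _ k) => n.
  - move=> v kn; apply/eqP; rewrite -leqn0 leqNgt; apply/negP => /XY/(_ hk).
    by case: (vertexP v) (vertexP w) => [] -> [] ->; rewrite ?level1 ?level2; lia.
  - move=> v nk; apply/eqP; rewrite -leqn0 leqNgt; apply/negP => h.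
    have := PY _ _ h; rewrite (PY _ _ hk) => /(pphase_inj ch)[e _].
    by rewrite e ltxx in nk.
  - have [|hX] := posnP (hdim X k n); first by left.
    have [|hY] := posnP (hdim Y k n); first by right.
    by have := XY _ _ _ _ hX hY; rewrite ltxx.
have [N HN_] := hdim_bound X.
have Y0 (k : int) w : hdim Y k w = 0%N.
  by apply/eqP; rewrite -leqn0 leqNgt; apply/negP => h; apply: noY; exists k, w.
(* For acyclic Y, cut above all the cohomology of X. *)
apply: (@Dhom0_of_hdim _ _ _ _ N%:Z) => // [|v]; last by right.
move=> n v Nn; have Nn' : (N < `|n|)%N by lia.
by case: (HN_ n Nn' v).
Qed.

Lemma expi_pi_int (k : int) : expi (pi * k%:~R) = (-1) ^+ `|k|%N :> C.
Proof.
have pos (n : nat) : expi (pi * n%:R) = (-1) ^+ n :> C.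
  elim: n => [|n IH]; first by rewrite mulr0 /expi cos0 sin0.
  rewrite -addn1 natrD mulrDr mulr1 expiD IH exprD expr1.
  by rewrite /expi cospi sinpi; congr (_ * _); apply/eqP; rewrite eq_complex /= oppr0 !eqxx.
case: k => n; first exact: pos.
rewrite NegzE abszN absz_nat -pos mulrNz mulrN -pmulrn /expi cosN sinN.
have := pos n.+1; rewrite /expi => /(congr1 (@complex.Im R)) /= s0.
by rewrite s0 -signr_odd; case: odd; rewrite /= ?oppr0.
Qed.

Lemma expi_pphase ph (n : int) v :
  expi (pi * pphase ph n v) = (-1) ^+ `|(n + 1)%R|%N * expi (pi * ph v) :> C.
Proof.
rewrite /pphase mulrBr -mulrN -mulrNz addrC expiD expi_pi_int abszN.
by [].
Qed.

Lemma K0class_pure E (n : int) v : pure E n v ->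
  K0class E = delta_mx 0 v *~ ((-1) ^+ `|(n + 1)%R|%N * (hdim E n v)%:Z).
Proof.
move=> [_ pE]; apply/rowP => w; rewrite K0classE.
rewrite (@sum_int_single _ _ n) => [|k kn]; last first.
  rewrite (_ : hdim E k w = 0%N) ?mulr0 //.
  by apply/eqP; rewrite -leqn0 leqNgt; apply/negP => /pE[/eqP]; rewrite (negPf kn).
rewrite -scaler_int intz !mxE eqxx /=.
case: (eqVneq w v) => [->|wv]; first by rewrite mulr1.
rewrite mulr0 (_ : hdim E n w = 0%N) ?mulr0 //.
by apply/eqP; rewrite -leqn0 leqNgt; apply/negP => /pE[_ /eqP]; rewrite (negPf wv).
Qed.

Lemma hsum_pure E (n : int) v w : pure E n v ->
  hsum E w = if w == v then hdim E n v else 0%N.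
Proof.
move=> [_ pE]; rewrite /hsum (@sum_int_single _ _ n) => [|k kn].
  case: eqVneq => [-> //|wv]; apply/eqP; rewrite -leqn0 leqNgt.
  by apply/negP => /pE[_ /eqP]; rewrite (negPf wv).
by apply/eqP; rewrite -leqn0 leqNgt; apply/negP => /pE[/eqP]; rewrite (negPf kn).
Qed.

Lemma normc_sgn (k : nat) (z : C) : normc ((-1) ^+ k * z) = normc z.
Proof. by rewrite -signr_odd; case: odd; rewrite ?mul1r // mulN1r normcN. Qed.

(** A sum over both vertices although one term survives, because this form adds up over the factors
    of a filtration. *)
Lemma normc_pure (c : {additive 'rV[int]_2 -> C}) E (n : int) v : pure E n v ->
  normc (c (K0class E)) = \sum_w normc (c (delta_mx 0 w)) * (hsum E w)%:R.
Proof.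
move=> pE; rewrite (K0class_pure pE) raddfMz.
rewrite (bigD1 v) //= (hsum_pure _ pE) eqxx big1 ?addr0 => [|w wv]; last first.
  by rewrite (hsum_pure _ pE) (negPf wv) mulr0.
rewrite -mulrzl intrM rmorphXn rmorphN1 -mulrA normc_sgn.
by rewrite mulrzl -pmulrn normcMn mulr_natr.
Qed.

End Stability.

(** * Stability conditions with prescribed phases and masses of the simples *)

Section Stability.
Local Open Scope classical_set_scope.
Context {R : realType} {l : nat}.
Local Notation C := R[i].
Local Notation obj := (cpx C l).
Implicit Types (E X Y : obj).

Definition kcharge (z : 'I_2 -> C) (x : 'rV[int]_2) : C := \sum_v z v *~ x 0 v.

Lemma kcharge_is_zmod_morphism z : zmod_morphism (kcharge z).
Proof.
move=> x y; rewrite /kcharge -sumrB; apply: eq_bigr => v _.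
by rewrite !mxE mulrzBr.
Qed.

HB.instance Definition _ z := GRing.isZmodMorphism.Build _ _ (kcharge z)
  (kcharge_is_zmod_morphism z).

Definition polar (m ph : 'I_2 -> R) (v : 'I_2) : C :=
  (m v)%:C%C * expi (pi * ph v).

Lemma kcharge_delta z v : kcharge z (delta_mx 0 v) = z v.
Proof.
rewrite /kcharge (bigD1 v) //= mxE !eqxx big1 ?addr0 // => w wv.
by rewrite mxE (negPf wv) andbF.
Qed.

Lemma polarMn m ph v (k : nat) :
  polar m ph v *~ k%:Z = (m v * k%:R)%:C%C * expi (pi * ph v).
Proof. by rewrite /polar -mulrzr -pmulrn rmorphM rmorph_nat mulrAC. Qed.

Section Construction.
Context (nrm : 'rV[R]_2 -> R) (hnrm : is_norm nrm).
Context (ph m : 'I_2 -> R) (ch : chamber ph) (m0 : forall v, 0 < m v).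

Lemma kslice_charge phi E : ~ is_zero E -> kslice ph phi E ->
  exists2 r : R, 0 < r &
    kcharge (polar m ph) (K0class E) = r%:C%C * expi (pi * phi).
Proof.
move=> E0 PE; have [n [v [-> pE]]] := kslice_pure ch PE E0.
exists (m v * (hdim E n v)%:R); first by rewrite mulr_gt0 // ltr0n pE.1.
rewrite (K0class_pure pE) raddfMz /= kcharge_delta expi_pphase.
by rewrite mulrC mulrzA polarMn -mulrzl rmorphXn rmorphN1 mulrCA.
Qed.

Lemma kslice_support : exists2 c : R, 0 < c &
  forall phi E, ~ is_zero E -> kslice ph phi E ->
    nrm (map_mx intr (K0class E)) < c * normc (kcharge (polar m ph) (K0class E)).
Proof.
have [_ nrmZ _] := hnrm.
pose N v : R := `|nrm (delta_mx 0 v)|.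
(* The sum dominates each ratio of norm to mass on a basis vector; the 1 makes the bound strict. *)
pose c := 1 + \sum_v N v / m v; exists c.
  by rewrite ltr_pwDl // sumr_ge0 // => v _; rewrite divr_ge0 ?normr_ge0 // ltW.
move=> phi E E0 PE; have [n [v [_ pE]]] := kslice_pure ch PE E0.
rewrite (normc_pure _ pE) (bigD1 v) //= big1 ?addr0 => [|w wv]; last first.
  by rewrite (hsum_pure _ pE) (negPf wv) mulr0.
rewrite (hsum_pure _ pE) eqxx kcharge_delta /polar normc_polar //.
rewrite (K0class_pure pE).
have -> : map_mx intr (delta_mx 0 v *~ ((-1) ^+ `|(n + 1)%R|%N * (hdim E n v)%:Z)) =
    ((-1) ^+ `|(n + 1)%R|%N * (hdim E n v)%:R) *: (delta_mx 0 v : 'rV[R]_2).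
  apply/rowP => w; rewrite -scaler_int intz !mxE !intrM rmorphXn rmorphN1.
  by case: (_ && _); rewrite /= ?mulr1z ?mulr0z ?mulr1 ?mulr0.
rewrite nrmZ normrM normrX normrN1 expr1n mul1r normr_nat.
rewrite mulrA [ltRHS]mulrC ltr_pM2l ?ltr0n ?pE.1 //.
rewrite (le_lt_trans (ler_norm _)) // -ltr_pdivrMr //.
rewrite /c (bigD1 v) //= addrCA ltrDl ltr_pwDl // sumr_ge0 // => w _.
by rewrite divr_ge0 ?normr_ge0 // ltW.
Qed.

Definition kstab : stab l nrm := @Stab R l nrm (kcharge (polar m ph)) (kslice ph)
  (@kslice_iso R l ph) (@kslice0 R l ph) (@kslice_sum R l ph) kslice_charge
  (@kslice_shift R l ph) (fun phi1 phi2 X Y => @kslice_hom0 R l ph phi1 phi2 X Y ch)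
  (fun E _ => HN_kslice E ch) kslice_support.

Hypothesis ph01 : 0 < ph v1 /\ ph v2 <= 1.

Lemma ph_bounds v : 0 < ph v <= 1.
Proof.
by case/andP: ch => ? ?; case: ph01 => ? ?; case: (vertexP v) => ->; apply/andP; lra.
Qed.

Lemma arg_polar (r a : R) : 0 < r -> 0 < a <= pi -> arg (r%:C%C * expi a) = a.
Proof.
move=> r0 a0; apply: xget_unique; first by split => //; exists r.
move=> b [b0 [s s0 eq]]; have rs : r = s.
  by have := congr1 (@normc R) eq; rewrite !normc_polar.
move: eq; rewrite -rs => /mulfI; rewrite eq_complex /= negb_and gt_eqF //=.
move=> /(_ isT) /(congr1 (@complex.Re R)) /= /cos_inj -> //; rewrite in_itv /=.
  by case/andP: a0 => /ltW -> ->.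
by case/andP: b0 => /ltW -> ->.
Qed.

Lemma kcharge_stalk (M : rep C l) :
  kcharge (polar m ph) (K0class (stalk M)) =
  \sum_v (m v * (M v)%:R)%:C%C * expi (pi * ph v).
Proof.
rewrite K0class_stalk /kcharge; apply: eq_bigr => v _.
by rewrite mxE polarMn.
Qed.

Lemma arg_concentrated (M : rep C l) v : (0 < M v)%N -> (forall w, w != v -> M w = 0%N) ->
  arg (kcharge (polar m ph) (K0class (stalk M))) = pi * ph v.
Proof.
move=> Mv Mw; rewrite kcharge_stalk (bigD1 v) //= big1 ?addr0 => [|w wv]; last first.
  by rewrite Mw // mulr0 mul0r.
have [/andP[p0 p1] pi0] := (ph_bounds v, pi_gt0 R).
by rewrite arg_polar // mulr_gt0 ?ltr0n //= ler_piMr // ltW.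
Qed.

(** Rotating by [- (pi * ph v2)] makes the v2 term real and leaves the v1 term with negative
    imaginary part. *)
Lemma arg_mixed (M : rep C l) : (0 < M v1)%N ->
  arg (kcharge (polar m ph) (K0class (stalk M))) < pi * ph v2.
Proof.
move=> Mv; rewrite kcharge_stalk big_ord_recl big_ord1 /=.
rewrite (_ : lift ord0 ord0 = v2); last exact: val_inj.
have [p1 p2] := (ph_bounds v1, ph_bounds v2).
set a1 := pi * ph v1; set a2 := pi * ph v2.
set r1 := m v1 * _; set r2 := m v2 * _.
have pi0 := pi_gt0 R.
have a20 : 0 < a2 by rewrite mulr_gt0 //; case/andP: p2.
(* If no argument existed, the default 0 would also lie below [a2]. *)
rewrite /arg; case: xgetP => // A _ [/andP[A0 Api] [r r0 eq]].
rewrite ltNge; apply/negP => a2A.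
have sinE : r * sin (A - a2) = r1 * sin (a1 - a2).
  move: eq; rewrite /expi => /eqP; rewrite eq_complex /=.
  rewrite !mul0r !subr0 !addr0 => /andP[/eqP eRe /eqP eIm].
  rewrite !sinB !mulrBr !mulrA.
  have -> : r * cos A * sin a2 = (r * cos A) * sin a2 by [].
  rewrite -eRe -eIm; ring.
have s1 : 0 < sin (a2 - a1).
  case/andP: ch => c1 c2; apply: sin_gt0_pi; rewrite -mulrBr mulr_gt0 ?subr_gt0 //=.
  by rewrite gtr_pMr //; lra.
have s2 : 0 <= sin (A - a2) by rewrite sin_ge0_pi // subr_ge0 a2A /=; lra.
have : 0 <= r * sin (A - a2) by rewrite mulr_ge0 // ltW.
rewrite sinE -opprB sinN mulrN oppr_ge0 leNgt mulr_gt0 //.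
by rewrite /r1 mulr_gt0 // ltr0n.
Qed.

Lemma K0class_simple v : K0class (stalk (simple C l v)) = delta_mx 0 v.
Proof.
by apply/rowP => w; rewrite K0class_stalk !mxE eqxx /=; case: (w == v).
Qed.

(** No arrow leaves v2, so any line there is a subrepresentation; the first coordinate line is
    taken. *)
Lemma simple_mono (M : rep C l) : (0 < M v2)%N ->
  exists i : rhom (simple C l v2) M, rmono i.
Proof.
move=> Mv; pose f v : 'M[C]_(simple C l v2 v, M v) :=
  \matrix_(i, j) (nat_of_ord j == 0%N)%:R.
have fP a : arr (simple C l v2) a *m f v2 = f v1 *m arr M a.
  by rewrite [RHS]flatmx0 [LHS]flatmx0.
exists (RHom fP) => v; case: (vertexP v) => -> /=.
  by rewrite /row_free [f v1]flatmx0 mxrank0.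
apply: inj_row_free => x /rowP/(_ (Ordinal Mv)); rewrite !mxE.
rewrite big_ord1 mxE mulr1 => x0; apply/rowP => i.
by rewrite (ord1 i) mxE.
Qed.

(** If M lived at both vertices, a copy of S_2 inside it would have larger phase by [arg_mixed]. *)
Lemma semistable_phase phi (M : rep C l) :
  semistable (kcharge (polar m ph)) phi M ->
  exists v, [/\ phi = ph v, (0 < M v)%N & forall w, w != v -> M w = 0%N].
Proof.
move=> [[u Mu] phiE sub].
have arg0 : (0 < M v1)%N -> (0 < M v2)%N -> False.
  move=> M1 M2; have [i imono] := simple_mono M2.
  have A0 : rep_neq0 (simple C l v2) by exists v2.
  have := le_lt_trans (sub _ i A0 imono) (arg_mixed M1).
  by rewrite (arg_concentrated (v := v2)) ?ltxx // => w; case: (vertexP w) => ->.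
have Mw w : w != u -> M w = 0%N.
  move=> wu; apply/eqP; rewrite -leqn0 leqNgt; apply/negP => Mw.
  by move: wu Mu Mw; case: (vertexP u) (vertexP w) => [] -> [] -> // _ Mu Mw; apply: arg0.
exists u; split => //; rewrite phiE (arg_concentrated Mu Mw).
by rewrite mulrAC divff ?mul1r // gt_eqF // pi_gt0.
Qed.

Lemma rmono_le (A M : rep C l) (i : rhom A M) v : rmono i -> (A v <= M v)%N.
Proof. by move=> /(_ v) /eqP <-; exact: rank_leq_col. Qed.

Lemma concentrated_semistable (M : rep C l) v :
  (0 < M v)%N -> (forall w, w != v -> M w = 0%N) ->
  semistable (kcharge (polar m ph)) (ph v) M.
Proof.
move=> Mv Mw; split; first by exists v.
  by rewrite (arg_concentrated Mv Mw) mulrAC divff ?mul1r // gt_eqF // pi_gt0.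
move=> A i [u Au] imono; have Aw w : w != v -> A w = 0%N.
  by move=> /Mw M0; apply/eqP; rewrite -leqn0 -M0 (rmono_le _ imono).
have uv : u = v by apply/eqP; apply: contraLR Au => /Aw ->.
by rewrite uv in Au; rewrite (arg_concentrated Mv Mw) (arg_concentrated Au Aw).
Qed.

Lemma kstab_standard : standard kstab.
Proof.
split=> [v|phi /andP[phi0 phi1] E] /=.
  exists (m v), (ph v); rewrite K0class_simple kcharge_delta.
  by split => //; exact: ph_bounds.
split=> [PE|[|[M sM /isomorphic_sym EM]]]; last first.
- apply: (kslice_iso EM) => n v.
  have [n1|n1] := eqVneq n (-1); last by rewrite hdim_stalk0.
  rewrite n1 hdim_stalk /pphase addNr subr0; have [u [-> _ Mw]] := semistable_phase sM.
  by have [-> //|/Mw ->] := eqVneq v u.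
- exact: kslice0.
have [E0|E0] := pselect (is_zero E); [by left|right].
have [n [v [phiE [hv pE]]]] := kslice_pure ch PE E0.
(* Both [phi] and [ph v] lie in (0, 1], so they cannot differ by a nonzero integer. *)
have n1 : n = -1.
  have /andP[v0 v1] := ph_bounds v; move: phiE; rewrite /pphase => phiE.
  have : (-1)%:~R < (n + 1)%:~R :> R by rewrite rmorphN1; lra.
  have : (n + 1)%:~R < 1%:~R :> R by lra.
  by rewrite !ltr_int; lia.
have [|M EM ME] := stalk_of_hdim (X := E).
  move=> k w k1; apply/eqP; rewrite -leqn0 leqNgt; apply/negP => /pE[kn _].
  by rewrite kn n1 eqxx in k1.
exists M => //; rewrite phiE n1 /pphase addNr subr0.
apply: concentrated_semistable; first by rewrite ME -n1.
move=> w wv; rewrite ME -n1; apply/eqP; rewrite -leqn0 leqNgt.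
by apply/negP => /pE[_ /eqP]; rewrite (negPf wv).
Qed.

Lemma kstab_dagger : stab_dagger kstab.
Proof. by exists kstab; [exact: kstab_standard|exact: connected_component_refl]. Qed.

End Construction.
End Stability.

(** * The metric in the chamber *)

Section Stability.
Local Open Scope classical_set_scope.
Context {R : realType} {l : nat}.
Local Notation C := R[i].
Local Notation obj := (cpx C l).
Implicit Types (E X Y : obj).

Context {nrm : 'rV[R]_2 -> R}.
Implicit Types (s t : stab l nrm) (ph m : 'I_2 -> R).

(* s lies in the chamber where only the shifts of S_1 and S_2 are stable *)
Definition adapted s ph m : Prop :=
  [/\ chamber ph, forall v, 0 < m v, slice s = kslice ph &
      forall v, normc (charge s (delta_mx 0 v)) = m v].

Lemma hn_len_gt0 (P : R -> set obj) E (h : HN P E) : ~ is_zero E -> (0 < hn_len h)%N.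
Proof.
move=> E0; rewrite lt0n; apply/negP => /eqP len0; apply: E0.
by rewrite -(hn_end h) len0; exact: hn_start.
Qed.

Lemma pphase_le ph (n n' : int) v v' : chamber ph ->
  (pphase ph n' v' <= pphase ph n v) = (level n v <= level n' v').
Proof. by move=> ch; rewrite !leNgt pphase_lt. Qed.

(** Smallest level means largest phase. As [ph] does not occur, one pair (n, v) serves both
    stability conditions under comparison. *)
Definition hfirst E (n : int) v : Prop := (0 < hdim E n v)%N /\
  forall (k : int) w, (0 < hdim E k w)%N -> level n v <= level k w.

Definition hlast E (n : int) v : Prop := (0 < hdim E n v)%N /\
  forall (k : int) w, (0 < hdim E k w)%N -> level k w <= level n v.

Lemma hn_phase_first ph E (h : HN (kslice ph) E) (n : int) v : chamber ph ->
  hfirst E n v -> hn_phase h 0 = pphase ph n v.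
Proof.
move=> ch [hp top]; have l0 := hn_len_gt0 h (not_zero hp).
have [i il iE] := hdim_hn_phase ch h hp.
have [k [w [kE kw]]] := hn_phase_hdim ch l0.
apply/eqP; rewrite eq_le {1}kE (pphase_le _ _ _ _ ch) top //= -iE.
by case: i il {iE} => // i il; apply/ltW/hn_decr.
Qed.

Lemma hn_phase_last ph E (h : HN (kslice ph) E) (n : int) v : chamber ph ->
  hlast E n v -> hn_phase h (hn_len h).-1 = pphase ph n v.
Proof.
move=> ch [hp bot]; have l0 := hn_len_gt0 h (not_zero hp).
have l1 : ((hn_len h).-1 < hn_len h)%N by rewrite prednK.
have [i il iE] := hdim_hn_phase ch h hp.
have [k [w [kE kw]]] := hn_phase_hdim ch l1.
apply/eqP; rewrite eq_le {2}kE (pphase_le _ _ _ _ ch) bot // andbT -iE.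
have : (i <= (hn_len h).-1)%N by rewrite -ltnS prednK.
by rewrite leq_eqVlt => /orP[/eqP -> //|il1]; apply/ltW/hn_decr.
Qed.

Lemma hfirst_ex E : ~ is_zero E -> exists (n : int) v, hfirst E n v.
Proof.
(* An auxiliary point of the chamber; the first factor of a filtration for it attains the smallest
   level. *)
move=> E0; pose ph (v : 'I_2) : R := if v == v2 then 2^-1 else 0.
have ch : chamber ph by rewrite /chamber /ph /=; lra.
have [h] := HN_kslice E ch; have [k [w [kE kw]]] := hn_phase_hdim ch (hn_len_gt0 h E0).
exists k, w; split => // n v /(hdim_hn_phase ch h)[i il iE].
rewrite -(pphase_le _ _ _ _ ch) -iE -kE.
by case: i il {iE} => // i il; apply/ltW/hn_decr.
Qed.

Lemma hlast_ex E : ~ is_zero E -> exists (n : int) v, hlast E n v.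
Proof.
move=> E0; pose ph (v : 'I_2) : R := if v == v2 then 2^-1 else 0.
have ch : chamber ph by rewrite /chamber /ph /=; lra.
have [h] := HN_kslice E ch; have l0 := hn_len_gt0 h E0.
have l1 : ((hn_len h).-1 < hn_len h)%N by rewrite prednK.
have [k [w [kE kw]]] := hn_phase_hdim ch l1.
exists k, w; split => // n v /(hdim_hn_phase ch h)[i il iE].
rewrite -(pphase_le _ _ _ _ ch) -iE -kE.
have : (i <= (hn_len h).-1)%N by rewrite -ltnS prednK.
by rewrite leq_eqVlt => /orP[/eqP -> //|il1]; apply/ltW/hn_decr.
Qed.

Lemma phase_maxE s ph m E (n : int) v :
  adapted s ph m -> hfirst E n v -> phase_max s E = pphase ph n v.
Proof.
move=> [ch _ sE _] top; rewrite /phase_max; move: (slice s) sE => P ->.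
have [h] := HN_kslice E ch.
apply: xget_unique; first by exists h => //; exact: hn_phase_first.
by move=> _ [h' _ <-]; exact: hn_phase_first.
Qed.

Lemma phase_minE s ph m E (n : int) v :
  adapted s ph m -> hlast E n v -> phase_min s E = pphase ph n v.
Proof.
move=> [ch _ sE _] bot; rewrite /phase_min; move: (slice s) sE => P ->.
have [h] := HN_kslice E ch.
apply: xget_unique; first by exists h => //; exact: hn_phase_last.
by move=> _ [h' _ <-]; exact: hn_phase_last.
Qed.

Lemma massE s ph m E : adapted s ph m -> mass s E = \sum_v m v * (hsum E v)%:R.
Proof.
move=> [ch _ sE mE]; rewrite /mass /hn_mass; move: (slice s) sE => P ->.
have H (h : HN (kslice ph) E) :
    \sum_(i < hn_len h) normc (charge s (K0class (hn_fac h i))) =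
    \sum_v m v * (hsum E v)%:R.
  transitivity (\sum_(i < hn_len h) \sum_v m v * (hsum (hn_fac h i) v)%:R).
    apply: eq_bigr => i _; have [n [v [_ pA]]] := hn_fac_pure ch (ltn_ord i).
    by rewrite (normc_pure _ pA); apply: eq_bigr => w _; rewrite mE.
  rewrite exchange_big; apply: eq_bigr => v _ /=.
  by rewrite -mulr_sumr -natr_sum -(hn_hsum ch (leqnn _)) hn_end.
have [h] := HN_kslice E ch.
apply: xget_unique; first by exists h.
by move=> _ [h' _ <-]; exact: H.
Qed.

Lemma ln_le_expR (x D : R) : 0 < x -> (ln x <= D) = (x <= expR D).
Proof. by move=> x0; rewrite -[in RHS](lnK x0) ler_expR. Qed.

(** Extreme phases of an object occur at the same (n, v) for [s] and [t], and its masses combine [m]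
    and [m'] with the same nonnegative coefficients, so the simples are the worst case. *)
Lemma dB_le s t ph m ph' m' (D : R) : adapted s ph m -> adapted t ph' m' ->
  (forall v, `|ph v - ph' v| <= D) -> (forall v, `|ln (m v / m' v)| <= D) ->
  (dB s t <= D%:E)%E.
Proof.
move=> sA tA phD mD; have [[_ m0 _ _] [_ m0' _ _]] := (sA, tA).
apply: ge_ereal_sup => _ [E E0 [->|->|->]]; rewrite lee_fin.
- have [n [v top]] := hfirst_ex E0.
  rewrite (phase_maxE sA top) (phase_maxE tA top) /pphase.
  by rewrite opprB addrA subrK; exact: phD.
- have [n [v bot]] := hlast_ex E0.
  rewrite (phase_minE sA bot) (phase_minE tA bot) /pphase.
  by rewrite opprB addrA subrK; exact: phD.
- have [ms mt] := (mass_gt0 s E0, mass_gt0 t E0).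
  have bound (a b : 'I_2 -> R) : (forall v, 0 < a v) -> (forall v, 0 < b v) ->
      (forall v, `|ln (a v / b v)| <= D) ->
      \sum_v a v * (hsum E v)%:R <= expR D * \sum_v b v * (hsum E v)%:R.
    move=> a0 b0 ab; rewrite mulr_sumr; apply: ler_sum => v _.
    rewrite mulrA ler_wpM2r ?ler0n // -ler_pdivrMr // -ln_le_expR ?divr_gt0 //.
    exact: le_trans (ler_norm _) (ab v).
  rewrite ler_norml lerNl -lnV ?posrE ?divr_gt0 // invf_div !ln_le_expR ?divr_gt0 //.
  rewrite !ler_pdivrMr // (massE _ sA) (massE _ tA) !bound // => v.
  by rewrite -invf_div lnV ?posrE ?divr_gt0 // normrN.
Qed.

Lemma hsum_stalk (M : rep C l) v : hsum (stalk M) v = M v.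
Proof.
rewrite /hsum (@sum_int_single _ _ (-1)) ?hdim_stalk // => n n1.
by rewrite hdim_stalk0.
Qed.

Lemma dB_ge_phase s t ph m ph' m' v : adapted s ph m -> adapted t ph' m' ->
  (`|ph v - ph' v|%:E <= dB s t)%E.
Proof.
move=> sA tA; pose E : obj := stalk (simple C l v).
have hv : (0 < hdim E (-1) v)%N by rewrite hdim_stalk /= eqxx.
have top : hfirst E (-1) v.
  split => // k w; have [->|k1] := eqVneq k (-1); last by rewrite hdim_stalk0.
  by rewrite hdim_stalk /=; case: eqVneq => // ->.
apply: ereal_sup_ubound; exists E; first exact: not_zero hv.
by apply: Or31; rewrite (phase_maxE sA top) (phase_maxE tA top) /pphase addNr !subr0.
Qed.

Lemma dB_ge_mass s t ph m ph' m' v : adapted s ph m -> adapted t ph' m' ->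
  (`|ln (m v / m' v)|%:E <= dB s t)%E.
Proof.
move=> sA tA; pose E : obj := stalk (simple C l v).
have hv : (0 < hdim E (-1) v)%N by rewrite hdim_stalk /= eqxx.
have mv (a : 'I_2 -> R) : \sum_w a w * (hsum E w)%:R = a v.
  rewrite (bigD1 v) //= hsum_stalk /= eqxx mulr1 big1 ?addr0 // => w wv.
  by rewrite hsum_stalk /= (negPf wv) mulr0.
apply: ereal_sup_ubound; exists E; first exact: not_zero hv.
by apply: Or33; rewrite (massE _ sA) (massE _ tA) !mv.
Qed.

Lemma adapted_act s ph m (lam : C) : adapted s ph m ->
  adapted (act s lam) (fun v => ph v - complex.Re lam)
                      (fun v => expR (pi * complex.Im lam) * m v).
Proof.
move=> [/andP[p12 p21] m0 sE mE]; split.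
- by apply/andP; lra.
- by move=> v; rewrite mulr_gt0 ?expR_gt0.
- apply/funext => phi; rewrite /= /act_slice sE; apply/seteqP.
  by split=> E PE n v /PE; rewrite /pphase; lra.
- by move=> v; rewrite /= normcM normc_expC_rot mE.
Qed.

Lemma adapted_orbit s s' ph m : adapted s ph m -> orbit s = orbit s' ->
  exists c k : R, adapted s' (fun v => ph v - c) (fun v => expR k * m v).
Proof.
(* [act s' 0] is in the orbit by definition and has the slices and moduli of [s'], which is all that
   [adapted] reads. *)
move=> sA ss'; have : orbit s (act s' 0) by rewrite ss'; exists 0.
move=> [lam _ eq]; exists (complex.Re lam), (pi * complex.Im lam).
have [ch m0 sE mE] := adapted_act lam sA; rewrite eq in sE mE; split => //.
  apply/funext => phi; rewrite -sE /= /act_slice /= addr0.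
  by [].
move=> v; rewrite -mE /= normcM normc_expC_rot /= mulr0 expR0 mul1r.
by [].
Qed.

End Stability.

(** * Two geodesics *)

Section Stability.
Local Open Scope classical_set_scope.
Context {R : realType} {l : nat}.
Local Notation C := R[i].
Local Notation obj := (cpx C l).
Implicit Types (E X Y : obj).

Context {nrm : 'rV[R]_2 -> R}.
Implicit Types (s t : stab l nrm) (ph m : 'I_2 -> R) (O : @stab_quot R l nrm).

(* (x, y) are the coordinates ph v2 - ph v1 and ln (m v2 / m v1) of the class
   modulo the action of C. *)
Definition coords s (x y : R) : Prop := exists ph m,
  [/\ adapted s ph m, ph v2 - ph v1 = x & ln (m v2 / m v1) = y].

Lemma coords_repr O s x y : proj1_sig O = orbit s -> coords s x y ->
  coords (orbit_repr O) x y.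
Proof.
move=> Os [ph [m [sA <- <-]]].
have Or : proj1_sig O = orbit (orbit_repr O).
  by rewrite /orbit_repr; case: cid2.
have [|c [k rA]] := adapted_orbit (s' := orbit_repr O) sA; first by rewrite -Os.
exists (fun v => ph v - c), (fun v => expR k * m v); split => //.
  by lra.
by rewrite invfM mulrACA divff ?mul1r // gt_eqF // expR_gt0.
Qed.

(** Each coordinate difference is the displacement at v2 minus that at v1, where [lam] cancels; both
    displacements are bounded by the distance, hence the factor 2. *)
Lemma dB_act_ge s t x y x' y' lam : coords s x y -> coords t x' y' ->
  ((Num.max `|x - x'| `|y - y'| / 2)%:E <= dB s (act t lam))%E.
Proof.
move=> [ph [m [sA <- <-]]] [ph' [m' [tA <- <-]]].
have lA := adapted_act lam tA.
have [_ m0 _ _] := sA; have [_ m0' _ _] := tA.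
have [_ ml0 _ _] := lA.
have p1 := dB_ge_phase v1 sA lA; have p2 := dB_ge_phase v2 sA lA.
have q1 := dB_ge_mass v1 sA lA; have q2 := dB_ge_mass v2 sA lA.
case: (dB s (act t lam)) p1 p2 q1 q2 => [r| |];
  [|by move=> *; rewrite leey|by rewrite leeNy_eq].
rewrite !lee_fin => p1 p2 q1 q2.
rewrite ler_pdivrMr // ge_max; apply/andP; split.
  rewrite (_ : _ - _ = (ph v2 - (ph' v2 - complex.Re lam)) -
                       (ph v1 - (ph' v1 - complex.Re lam))); last by ring.
  by apply: (le_trans (ler_normB _ _)); lra.
rewrite (_ : _ - _ = ln (m v2 / (expR (pi * complex.Im lam) * m' v2)) -
                     ln (m v1 / (expR (pi * complex.Im lam) * m' v1))); last first.
  rewrite !ln_div ?posrE // !lnM ?posrE ?expR_gt0 //; ring.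
by apply: (le_trans (ler_normB _ _)); lra.
Qed.

Lemma dB_act_le s t x y x' y' : coords s x y -> coords t x' y' ->
  exists lam, (dB s (act t lam) <= (Num.max `|x - x'| `|y - y'| / 2)%:E)%E.
Proof.
move=> [ph [m [sA <- <-]]] [ph' [m' [tA <- <-]]].
have [_ m0 _ _] := sA; have [_ m0' _ _] := tA.
pose u v := ph v - ph' v; pose w v := ln (m v) - ln (m' v).
(* Recentres at the mean displacement, so that those at v1 and v2 become opposite, each half the
   difference; sign and pi follow [adapted_act]. *)
pose lam : C := Complex (- ((u v1 + u v2) / 2)) ((w v1 + w v2) / 2 / pi).
exists lam; apply: (dB_le sA (adapted_act lam tA)) => v /=.
  have -> : ph v - (ph' v - - ((u v1 + u v2) / 2)) = u v - (u v1 + u v2) / 2.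
    by rewrite /u; lra.
  rewrite ler_pdivlMr // -{2}(gtr0_norm (ltr0n R 2)) -normrM le_max; apply/orP; left.
  rewrite (_ : ph v2 - ph v1 - _ = u v2 - u v1); last by rewrite /u; ring.
  case: (vertexP v) => ->; [rewrite -normrN|]; rewrite le_eqVlt; apply/orP; left;
    by apply/eqP; congr (`|_|); lra.
have -> : ln (m v / (expR (pi * ((w v1 + w v2) / 2 / pi)) * m' v)) =
    w v - (w v1 + w v2) / 2.
  rewrite ln_div ?posrE ?mulr_gt0 ?expR_gt0 // lnM ?posrE ?expR_gt0 // expRK.
  by rewrite mulrC divfK ?gt_eqF ?pi_gt0 // /w; ring.
rewrite ler_pdivlMr // -{2}(gtr0_norm (ltr0n R 2)) -normrM le_max; apply/orP; right.
rewrite (_ : ln (m v2 / m v1) - _ = w v2 - w v1); last first.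
  by rewrite !ln_div ?posrE // /w; ring.
case: (vertexP v) => ->; [rewrite -normrN|]; rewrite le_eqVlt; apply/orP; left;
  by apply/eqP; congr (`|_|); lra.
Qed.

Lemma dB_quotE O O' x y x' y' :
  coords (orbit_repr O) x y -> coords (orbit_repr O') x' y' ->
  dB_quot O O' = Num.max `|x - x'| `|y - y'| / 2.
Proof.
move=> cO cO'; rewrite /dB_quot; set D := Num.max _ _ / 2.
suff -> : ereal_inf [set dB (orbit_repr O) (act (orbit_repr O') lam)
    | lam in [set: C]] = D%:E by [].
apply/eqP; rewrite eq_le; apply/andP; split.
  have [lam le] := dB_act_le cO cO'; apply: le_trans le.
  by apply: ereal_inf_lbound; exists lam.
by apply: le_ereal_inf_tmp => _ [lam _ <-]; exact: dB_act_ge.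
Qed.

(** Normalizes the orbit by phi(S_2) = 1 and |Z(S_1)| = 1; for x in (0, 1) both phases stay in (0,
    1], so the stability condition is standard. *)
Definition chart_ph (x : R) (v : 'I_2) : R := if v == v2 then 1 else 1 - x.
Definition chart_m (y : R) (v : 'I_2) : R := if v == v2 then expR y else 1.

Lemma chart_chamber x : 0 < x < 1 -> chamber (chart_ph x).
Proof. by move=> /andP[x0 x1]; rewrite /chamber /chart_ph /=; lra. Qed.

Lemma chart_m_gt0 y v : 0 < chart_m y v.
Proof. by rewrite /chart_m; case: ifP; rewrite ?expR_gt0. Qed.

Lemma chart_ph01 x : 0 < x < 1 -> 0 < chart_ph x v1 /\ chart_ph x v2 <= 1.
Proof. by move=> /andP[x0 x1]; rewrite /chart_ph /=; lra. Qed.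

Section Chart.
Hypothesis hnrm : is_norm nrm.

Definition chart_stab x y (hx : 0 < x < 1) : stab l nrm :=
  kstab hnrm (chart_chamber hx) (chart_m_gt0 y).

Lemma chart_dagger x y (hx : 0 < x < 1) : stab_dagger (chart_stab y hx).
Proof. exact: kstab_dagger (chart_ph01 hx). Qed.

Definition chart x y (hx : 0 < x < 1) : @stab_quot R l nrm :=
  exist _ (orbit (chart_stab y hx))
    (ex_intro2 _ _ (chart_stab y hx) (chart_dagger y hx) erefl).

Lemma coords_chart x y (hx : 0 < x < 1) : coords (orbit_repr (chart y hx)) x y.
Proof.
apply: (@coords_repr _ (chart_stab y hx)) => //.
exists (chart_ph x), (chart_m y); split.
- split => //; [exact: chart_chamber|exact: chart_m_gt0|move=> v].
  by rewrite /= kcharge_delta normc_polar // chart_m_gt0.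
- by rewrite /chart_ph /=; ring.
- by rewrite /chart_m /= divr1 expRK.
Qed.

Lemma dB_chart x y x' y' (hx : 0 < x < 1) (hx' : 0 < x' < 1) :
  dB_quot (chart y hx) (chart y' hx') = Num.max `|x - x'| `|y - y'| / 2.
Proof. by apply: dB_quotE; exact: coords_chart. Qed.

Lemma chart_eq x y x' y' (hx : 0 < x < 1) (hx' : 0 < x' < 1) :
  x = x' -> y = y' -> chart y hx = chart y' hx'.
Proof. by move=> e <-; case: x' / e hx' => hx'; rewrite (bool_irrelevance hx hx'). Qed.

Lemma geodesic_chart (x y : R -> R) (hx : forall a, 0 < x a < 1) P Q :
  chart (y 0) (hx 0) = P -> chart (y 1) (hx 1) = Q ->
  (forall a b, Num.max `|x a - x b| `|y a - y b| / 2 = dB_quot P Q * `|a - b|) ->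
  geodesic (@dB_quot R l nrm) P Q (fun a => chart (y a) (hx a)).
Proof.
move=> P0 Q1 xyE; have D0 : 0 <= dB_quot P Q.
  have := xyE 1 0; rewrite subr0 normr1 mulr1 => <-.
  by rewrite divr_ge0 // le_max normr_ge0.
split=> // [a _ e e0|a b _ _]; last by rewrite dB_chart.
(* The added 1 covers the constant geodesic. *)
exists (e / (dB_quot P Q + 1)); first by rewrite divr_gt0 // ltr_wpDl.
move=> b _; rewrite ltr_pdivlMr ?ltr_wpDl // dB_chart xyE => lt.
apply: le_lt_trans lt; rewrite mulrC ler_wpM2l //; lra.
Qed.

(** A tent of height 1/4, clamped outside [0, 1] because paths are defined on all of R and x must
    stay in (0, 1). Its slope is at most 1, so y alone determines the sup distance along the
    detour. *)
Definition bump (a : R) : R := Num.max 0 (Num.min a (1 - a)) / 2.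

Lemma bumpE a :
  [\/ bump a = 0 /\ (a <= 0 \/ 1 <= a), bump a = a / 2 /\ 0 <= a <= 1 - a |
      bump a = (1 - a) / 2 /\ 1 - a <= a <= 1].
Proof.
rewrite /bump; have [le|le] := leP a (1 - a).
  have [a0|a0] := leP 0 a; first by apply: Or32.
  by apply: Or31; split; [rewrite mul0r|lra].
have [a1|a1] := leP 0 (1 - a); first by apply: Or33; split => //; lra.
by apply: Or31; split; [rewrite mul0r|lra].
Qed.

Lemma bump_lipschitz a b : `|bump a - bump b| <= `|a - b|.
Proof.
have [n1 n2] := (ler_norm (a - b), ler_norm (- (a - b))); rewrite normrN in n2.
rewrite ler_norml; apply/andP.
by case: (bumpE a) (bumpE b) => [] [-> ?] [] [-> ?]; lra.
Qed.

Lemma bump_bounds a : 0 < 2^-1 + bump a < 1.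
Proof. by apply/andP; case: (bumpE a) => [] [-> ?]; lra. Qed.

Lemma bump0 : bump 0 = 0.
Proof. by case: (bumpE 0) => [] [-> ?]; lra. Qed.

Lemma bump_half_gt0 : 0 < bump 2^-1.
Proof. by case: (bumpE 2^-1) => [] [-> ?]; lra. Qed.

Lemma bumpC a : bump (1 - a) = bump a.
Proof. by rewrite /bump opprB addrCA subrr addr0 minC. Qed.

Lemma half01 : 0 < (2^-1 : R) < 1.
Proof. by apply/andP; lra. Qed.

Lemma eucl_axis (a b : R) : eucl (a, 0) (b, 0) = `|a - b|.
Proof. by rewrite /eucl /= subrr expr0n addr0 sqrtr_sqr. Qed.

Lemma eucl_refl (p : R * R) : eucl p p = 0.
Proof. by rewrite /eucl !subrr expr0n addr0 sqrtr0. Qed.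

Lemma segment_half (p q : R * R) : segment p q 2^-1 = segment q p 2^-1.
Proof. by rewrite /segment; congr pair; lra. Qed.

(* P and Q are joined by the straight segment and by a detour whose x-coordinate
   is bumped, and both are geodesics for the sup metric. *)
Lemma not_CAT0 : ~ CAT0 (@dB_quot R l nrm).
Proof.
move=> [_ cat0].
have h2 := half01.
pose P := chart 0 h2; pose Q := chart 1 h2.
have dPQ : dB_quot P Q = 2^-1.
  by rewrite dB_chart subrr normr0 sub0r normrN1 (max_idPr ler01) mul1r.
have dQP : dB_quot Q P = 2^-1.
  by rewrite dB_chart subrr normr0 subr0 normr1 (max_idPr ler01) mul1r.
have dQQ : dB_quot Q Q = 0 by rewrite dB_chart !subrr normr0 maxxx mul0r.
have gPQ : geodesic (@dB_quot R l nrm) P Q (fun a => chart a h2).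
  apply: (@geodesic_chart (fun=> 2^-1) id (fun=> h2)) => // a b.
  by rewrite subrr normr0 dPQ (max_idPr _) ?normr_ge0 // mulrC.
(* The constant side of the degenerate triangle P, Q, Q. *)
have gQQ : geodesic (@dB_quot R l nrm) Q Q (fun=> Q).
  apply: (@geodesic_chart (fun=> 2^-1) (fun=> 1) (fun=> h2)) => // a b.
  by rewrite dQQ !subrr normr0 maxxx !mul0r.
have gQP : geodesic (@dB_quot R l nrm) Q P
    (fun a => chart (1 - a) (bump_bounds a)).
  (* The detour runs backwards, as the third side must go from Q to P. *)
  apply: (@geodesic_chart (fun a => 2^-1 + bump a) (fun a => 1 - a) bump_bounds).
  - by apply: chart_eq; rewrite ?bump0 ?addr0 ?subr0.
  - by apply: chart_eq; rewrite -?(bumpC 1) ?subrr ?bump0 ?addr0.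
  - move=> a b; rewrite (_ : 1 - a - (1 - b) = - (a - b)); last by ring.
    rewrite normrN dQP (max_idPr _) 1?mulrC //.
    by rewrite opprD addrACA subrr add0r bump_lipschitz.
have h0 : 0 < (2^-1 : R) by case/andP: half01.
have eAB : eucl (0, 0) (2^-1, 0) = 2^-1 :> R.
  by rewrite eucl_axis sub0r normrN gtr0_norm.
have eBA : eucl (2^-1, 0) (0, 0) = 2^-1 :> R.
  by rewrite eucl_axis subr0 gtr0_norm.
have h01 : 0 <= (2^-1 : R) <= 1 by case/andP: half01 => /ltW -> /ltW ->.
pose A : R * R := (0, 0); pose B : R * R := (2^-1, 0).
have := cat0 _ _ _ _ _ _ gPQ gQQ gQP A B B _ _ _
  (chart 2^-1 h2) (segment A B 2^-1) (chart (1 - 2^-1) (bump_bounds 2^-1))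
  (segment B A 2^-1) _ _.
rewrite dPQ dQP dQQ dB_chart => /(_ eAB (eucl_refl B) eBA).
rewrite [segment B A _]segment_half eucl_refl.
(* The midpoints of the two long sides share a comparison point, so they would coincide, although
   their x-coordinates differ by [bump 2^-1]. *)
move=> H; have : Num.max `|2^-1 - (2^-1 + bump 2^-1)| `|2^-1 - (1 - 2^-1)| / 2 <= 0.
  apply: H; first by apply: Or31; exists 2^-1.
  by apply: Or33; exists 2^-1 => //; split => //; exact: segment_half.
rewrite pmulr_lle0 ?invr_gt0 // ge_max => /andP[+ _].
rewrite opprD addrA subrr sub0r normrN normr_le0 => /eqP b0.
by have := bump_half_gt0; rewrite b0 ltxx.
Qed.

End Chart.
End Stability.

Theorem theorem3p7 (R : realType) (l : nat) (hl : (1 <= l)%N)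
    (nrm : 'rV[R]_2 -> R) (hnrm : is_norm nrm) :
  ~ CAT0 (@dB_quot R l nrm).
Proof. exact: not_CAT0. Qed.
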